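(* Let $R$ be a semilocal ring with infinite residue fields of characteristic different from $2$. Let $(\mathcal A,\sigma)$ be an Azumaya algebra with unitary involution $\sigma$ over $R$, and let $C$ be the center of $\mathcal A$, so that $C$ is an étale quadratic $R$-algebra with standard involution $\sigma$. Then $$\mathrm{Nrd}_C(\mathrm U(\mathcal A))=\mathrm{Nrd}_C(\mathcal A^* )^{1-\sigma},$$ where $c^{1-\sigma}=c(c^\sigma)^{-1}$ for $c\in C^*$.
   Context: $R$ is a commutative noetherian ring with unit. An Azumaya algebra with unitary involution over $R$ is a pair $(\mathcal A,\sigma)$ where $\mathcal A$ is an $R$-algebra with an $R$-linear involution $\sigma$ (written $a\mapsto a^\sigma$) such that $\mathcal A$ is an Azumaya algebra over its center $C$, $C$ is an étale quadratic extension of $R$, and $C^\sigma=R$. $\mathrm U(\mathcal A)=\{a\in\mathcal A\mid aa^\sigma=1\}$; $\mathrm{Nrd}_C:\mathcal A^*\to C^*$ is the reduced norm. For a subset $X\subset C^*$, $X^{1-\sigma}=\{c(c^\sigma)^{-1}\mid c\in X\}$. *)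

(* Defs.v *)
From HB Require Import structures.
From mathcomp Require Import all_boot all_order all_algebra.
From mathcomp Require Import boolp classical_sets cardinality.

Set Implicit Arguments.
Unset Strict Implicit.
Unset Printing Implicit Defensive.

Import GRing.Theory.
Local Open Scope ring_scope.
Local Open Scope classical_set_scope.

Definition ideal (R : comNzRingType) (I : set R) : Prop :=
  I 0 /\ forall a u v : R, I u -> I v -> I (a * u + v).

Definition noetherian (R : comNzRingType) : Prop :=
  forall I : set R, ideal I ->
    exists (n : nat) (g : 'I_n -> R),
      I = [set x | exists r : 'I_n -> R, x = \sum_(i < n) r i * g i].

Definition prime_ideal (R : comNzRingType) (p : set R) : Prop :=
  [/\ ideal p, ~ p 1 & forall x y : R, p (x * y) -> p x \/ p y].

Definition maximal_ideal (R : comNzRingType) (m : set R) : Prop :=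
  [/\ ideal m, ~ m 1 &
      forall J : set R, ideal J -> m `<=` J -> ~ J 1 -> J = m].

Definition semilocal (R : comNzRingType) : Prop :=
  finite_set [set m : set R | maximal_ideal m].

(* The underlying set of the quotient R / m, as a set of cosets. *)
Definition cosets (R : comNzRingType) (m : set R) : set (set R) :=
  range (fun x : R => [set y | m (y - x)]).

Definition infinite_residue_fields (R : comNzRingType) : Prop :=
  forall m : set R, maximal_ideal m -> infinite_set (cosets m).

(* The residue field R / m has characteristic 2 exactly when 2 lies in m. *)
Definition residue_char_neq2 (R : comNzRingType) : Prop :=
  forall m : set R, maximal_ideal m -> ~ m 2%:R.

Definition fg_projective (R : comNzRingType) (M : lmodType R) : Prop :=
  exists (n : nat) (i : {linear M -> 'rV[R]_n}) (p : {linear 'rV[R]_n -> M}),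
    cancel i p.

(* The localization of M at p is free of rank n, with basis the images b_i/1
   (any basis of M_p can be brought to this form by clearing denominators). *)
Definition rank_at (R : comNzRingType) (M : lmodType R) (p : set R) (n : nat)
    : Prop :=
  exists b : 'I_n -> M,
    (forall x : M, exists (s : R) (r : 'I_n -> R),
        ~ p s /\ s *: x = \sum_(i < n) r i *: b i) /\
    (forall r : 'I_n -> R,
        (exists s : R, ~ p s /\ s *: (\sum_(i < n) r i *: b i) = 0) ->
        forall i : 'I_n, exists s : R, ~ p s /\ s * r i = 0).

(* An element of the tensor product of M and N over R is represented by a
   formal sum of pure tensors, i.e. by a sequence of pairs.  By the universal
   property, such a sum is zero in the tensor product if and only if it is
   killed by every R-bilinear map. *)
Definition tensor_null (R : comNzRingType) (M N : lmodType R)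
    (s : seq (M * N)) : Prop :=
  forall (V : lmodType R) (beta : {bilinear M -> N -> V}),
    \sum_(x <- s) beta x.1 x.2 = 0.

Definition flat (R : comNzRingType) (S : lmodType R) : Prop :=
  forall (M N : lmodType R) (g : {linear M -> N}), injective g ->
  forall s : seq (M * S),
    tensor_null [seq (g x.1, x.2) | x <- s] -> tensor_null s.

Definition faithfully_flat (R : comNzRingType) (S : lmodType R) : Prop :=
  flat S /\
  forall M : lmodType R,
    (forall s : seq (M * S), tensor_null s) -> forall x : M, x = 0.

Definition formally_etale (R : comNzRingType) (C : comAlgType R) : Prop :=
  forall (B B' : comAlgType R) (q : {lrmorphism B -> B'}),
    (forall y : B', exists x : B, q x = y) ->
    (forall x y : B, q x = 0 -> q y = 0 -> x * y = 0) ->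
    forall g : {lrmorphism C -> B'},
      (exists h : {lrmorphism C -> B}, forall c : C, q (h c) = g c) /\
      (forall h h' : {lrmorphism C -> B},
          (forall c : C, q (h c) = g c) -> (forall c : C, q (h' c) = g c) ->
          forall c : C, h c = h' c).

(* A finitely generated projective module is finitely presented, so formally
   etale is here the same as etale. *)
Definition etale_quadratic (R : comNzRingType) (C : comAlgType R) : Prop :=
  [/\ fg_projective C,
      forall p : set R, prime_ideal p -> rank_at C p 2 &
      formally_etale C].

(* A is a faithful finitely generated projective C-module and the sandwich map
   from the tensor product of A and A^op to End_C(A), sending a (x) b to the
   map y |-> a y b, is surjective and injective. *)
Definition azumaya (C : comNzRingType) (A : algType C) : Prop :=
  [/\ fg_projective A,
      forall c : C, (forall a : A, c *: a = 0) -> c = 0,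
      forall f : {linear A -> A}, exists s : seq (A * A),
        forall y : A, f y = \sum_(x <- s) x.1 * y * x.2 &
      forall s : seq (A * A),
        (forall y : A, \sum_(x <- s) x.1 * y * x.2 = 0) -> tensor_null s].

(* A finitely generated projective S-module P is the image of an idempotent e
   of 'M[S]_n, and then End_S(P) = e 'M[S]_n e.  The predicate says that f
   induces an isomorphism of S-algebras from the scalar extension of A to S
   onto End_S(P), where e = f 1.  Since A need not have constant rank, P is
   not required to be free. *)
Definition splitting (C : comNzRingType) (A : algType C) (S : comAlgType C)
    (n : nat) (f : A -> 'M[S]_n) : Prop :=
  [/\ forall (c : C) (a b : A), f (c *: a + b) = (c%:A : S) *: f a + f b,
      forall a b : A, f (a * b) = f a *m f b,
      forall X : 'M[S]_n, f 1 *m X *m f 1 = X ->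
        exists s : seq (A * S), X = \sum_(x <- s) x.2 *: f x.1 &
      forall s : seq (A * S),
        \sum_(x <- s) x.2 *: f x.1 = 0 -> tensor_null s].

(* The graph of the reduced norm: c = Nrd a when the determinant of a, acting
   on P through a faithfully flat splitting of A, is the image of c.
   For phi in e 'M[S]_n e the determinant of phi on P = im e is
   \det (phi + (1 - e)), i.e. phi is extended by the identity on im (1 - e). *)
Definition is_Nrd (C : comNzRingType) (A : algType C) (a : A) (c : C) : Prop :=
  exists (S : comAlgType C) (n : nat) (f : A -> 'M[S]_n),
    [/\ faithfully_flat S, splitting f &
        \det (f a + (1%:M - f 1)) = c%:A].

Definition Nrd_image (C : comNzRingType) (A : algType C) (X : set A) : set C :=
  [set c | exists2 a, X a & is_Nrd a c].

(* The center of A is given as the ring C of scalars, embedded in A by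
   c |-> c%:A (the embedding is injective since A is faithful), and A is an
   R-algebra through C.  sigmaC is the restriction of sigma to the center. *)
Record azumaya_unitary (R : comNzRingType) (C : comAlgType R) (A : algType C)
    (sigma : A -> A) (sigmaC : C -> C) : Prop := AzumayaUnitary {
  au_etale : etale_quadratic C;
  au_azumaya : azumaya A;
  au_center : forall z : A,
    (forall a : A, z * a = a * z) <-> exists c : C, z = c%:A;
  au_add : forall a b : A, sigma (a + b) = sigma a + sigma b;
  au_mul : forall a b : A, sigma (a * b) = sigma b * sigma a;
  au_inv : forall a : A, sigma (sigma a) = a;
  au_scale : forall (r : R) (a : A),
    sigma ((r%:A : C) *: a) = (r%:A : C) *: sigma a;
  au_restr : forall c : C, sigma c%:A = (sigmaC c)%:A;
  au_fixed : forall c : C, sigmaC c = c <-> exists r : R, c = r%:A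
}.

Definition unitary_group (C : comNzRingType) (A : algType C) (sigma : A -> A)
    : set A :=
  [set a | a * sigma a = 1].

(* This is X^{1 - sigma}; it is used for sets X of units of C only. *)
Definition one_minus (C : comUnitRingType) (sigmaC : C -> C) (X : set C)
    : set C :=
  [set c / sigmaC c | c in X].

(* Main.v *)
(* Fix a faithfully flat splitting f of A over S; at every field-valued point of S it
   becomes a full matrix algebra, and elements of A can be chosen there generically
   because the residue fields of R are infinite.

   Descent of the reduced norm.  If y is cyclic at a point, the relation of degree r
   satisfied by y (Cayley-Hamilton over S) is determined by C-linear functionals on A,
   so w Nrd(y) = w' for some w, w' in C with w nonzero at the point; a unit b is the
   quotient of the cyclic elements b y and y.  By the local-global principle and
   faithful flatness Nrd(b) lies in C, and applying sigma to the relations gives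
   Nrd(sigma b) = sigma(Nrd b).

   Let e be a skew element of C that is nonzero in all residue fields, and let
   theta = 1 + beta e with beta in R generic.  If u is unitary, y = theta + sigma(theta) u
   is a unit and u = y sigma(y)^-1, which gives one inclusion.  Conversely, for a unit a
   the equation theta a s - sigma(theta) s sigma(a) = e has a unique solution s in A; it
   is symmetric and invertible.  Then x = theta a s satisfies x - sigma(x) = e, so x
   commutes with sigma(x), and (sigma(theta) / theta) x sigma(x)^-1 is unitary of reduced
   norm Nrd(a) / sigma(Nrd(a)). *)

Require Import Defs.
From HB Require Import structures.
From mathcomp Require Import all_boot all_order all_algebra.
From mathcomp Require Import boolp classical_sets functions cardinality.
From mathcomp Require Import ring.

Set Implicit Arguments.
Unset Strict Implicit.
Unset Printing Implicit Defensive.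
Import GRing.Theory.
Local Open Scope ring_scope.
Local Open Scope classical_set_scope.

(** * Quotients and field-valued points *)

(** The degree of A may vary over the spectrum and the module P of a splitting need not be free, so
    nothing is normalized globally. A local fact is stored instead as the ideal of all elements that
    make it true after multiplication; such an ideal contains 1 as soon as it has, for each
    field-valued point, an element that does not vanish there. The locus of a given degree is cut
    out by an element of C, which brings denominators found over S back to C.

    The equation for s answers two demands. For x sigma(x)^-1 to be unitary up to a central factor,
    x should commute with sigma(x), and it does when x - sigma(x) is central. For s to disappear
    from the norm of x sigma(x)^-1, it should be symmetric, so that it contributes equally to x and
    to sigma(x). The parameter theta makes the equation solvable: without it the linear map z |-> a
    z - z sigma(a) can be singular, while for sigma(theta) = 0 only left multiplication by a unit
    would remain. A generic theta is close enough to this degenerate case. *)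

Definition ideal_pred (S : comNzRingType) (I : set S) (idI : ideal I)
    (I1 : ~ I 1) : {pred S} := fun x => `[< I x >].

Section IdealPred.
Variables (S : comNzRingType) (I : set S) (idI : ideal I) (I1 : ~ I 1).

Lemma ideal_pred_closed : idealr_closed (ideal_pred idI I1).
Proof.
split; first by apply/asboolP; case: idI.
  by apply/asboolP.
move=> a u v /asboolP Iu /asboolP Iv; apply/asboolP; exact: idI.2.
Qed.

HB.instance Definition _ := isIdealr.Build S (ideal_pred idI I1) ideal_pred_closed.

Definition quotient := {ideal_quot (ideal_pred idI I1)}.
HB.instance Definition _ := GRing.ComNzRing.on quotient.

Definition quotient_map (x : S) : quotient := (\pi_quotient x)%qT.

Lemma quotient_map_zmod : zmod_morphism quotient_map.
Proof. by move=> x y; rewrite /quotient_map raddfB. Qed.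
HB.instance Definition _ :=
  GRing.isZmodMorphism.Build S quotient quotient_map quotient_map_zmod.
Lemma quotient_map_monoid : monoid_morphism quotient_map.
Proof. by split; [exact: rmorph1 | move=> x y; exact: rmorphM]. Qed.
HB.instance Definition _ :=
  GRing.isMonoidMorphism.Build S quotient quotient_map quotient_map_monoid.

Lemma quotient_map_surj (q : quotient) : exists x, quotient_map x = q.
Proof. by exists (repr q)%qT; rewrite /quotient_map reprK. Qed.

Lemma quotient_map_eq0 x : quotient_map x = 0 <-> I x.
Proof.
rewrite -[0](rmorph0 quotient_map) /quotient_map; split.
  by move=> /eqP; rewrite -Quotient.idealrBE subr0 => /asboolP.
by move=> Ix; apply/eqP; rewrite -Quotient.idealrBE subr0; apply/asboolP.
Qed.

Definition quotient_unit : pred quotient := fun q => `[< exists y, y * q = 1 >].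
Definition quotient_inv (q : quotient) : quotient :=
  if pselect (exists y, y * q = 1) is left h then projT1 (cid h) else q.

Fact quotient_mulVx : {in quotient_unit, left_inverse 1 quotient_inv *%R}.
Proof.
move=> q /asboolP qu; rewrite /quotient_inv; case: pselect => // h.
by case: cid.
Qed.
Fact quotient_unitP (x y : quotient) : y * x = 1 -> quotient_unit x.
Proof. by move=> xy; apply/asboolP; exists y. Qed.
Fact quotient_inv_out : {in [predC quotient_unit], quotient_inv =1 id}.
Proof.
move=> q; rewrite inE => qu; rewrite /quotient_inv; case: pselect => // h.
by move/negP: qu; case; apply/asboolP.
Qed.
HB.instance Definition _ := GRing.ComNzRing_hasMulInverse.Build quotient
  quotient_mulVx quotient_unitP quotient_inv_out.

End IdealPred.

Section PrimePred.
Variables (S : comNzRingType) (P : set S) (idP : ideal P) (P1 : ~ P 1).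
Hypothesis primeP : forall x y : S, P (x * y) -> P x \/ P y.

(** The proof of primality is a dummy argument, so that the integral domain structure, which depends
    on it, can be attached to the type. *)
Definition domain_quotient of (forall x y : S, P (x * y) -> P x \/ P y) :=
  quotient idP P1.
HB.instance Definition _ := GRing.ComUnitRing.on (domain_quotient primeP).

Fact domain_quotient_integral (x y : domain_quotient primeP) :
  x * y = 0 -> (x == 0) || (y == 0).
Proof.
have [a <-] := quotient_map_surj x; have [b <-] := quotient_map_surj y.
rewrite -[_ * _](rmorphM (quotient_map idP P1)) => /quotient_map_eq0.
by case/primeP => /(quotient_map_eq0 idP P1) ->; rewrite eqxx ?orbT.
Qed.
HB.instance Definition _ := GRing.ComUnitRing_isIntegral.Build
  (domain_quotient primeP) domain_quotient_integral.
End PrimePred.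

(* The field is the fraction field of the quotient by P. *)
Lemma prime_ideal_field (S : comNzRingType) (P : set S) : prime_ideal P ->
  exists (L : fieldType) (phi : {rmorphism S -> L}), forall x, phi x = 0 <-> P x.
Proof.
case=> idP P1 primeP.
exists {fraction (domain_quotient idP P1 primeP)}.
pose q : {rmorphism S -> domain_quotient idP P1 primeP} :=
  quotient_map idP P1.
exists (@tofrac _ \o q) => x /=; rewrite -(quotient_map_eq0 idP P1); split.
  by move/eqP; rewrite tofrac_eq0 => /eqP.
by move=> qx; apply/eqP; rewrite tofrac_eq0; apply/eqP.
Qed.

(** * Zorn's lemma, prime ideals and local-global principles *)

Section Zorn.
Variable S : comNzRingType.
Implicit Types I J P m : set S.

Lemma idealD I x y : ideal I -> I x -> I y -> I (x + y).
Proof. by case=> _ h Ix Iy; rewrite -[x]mul1r; exact: h. Qed.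

Lemma idealM I a x : ideal I -> I x -> I (a * x).
Proof. by case=> I0 h Ix; rewrite -[_ * _]addr0; exact: h. Qed.

Lemma ideal_sum I (T : Type) (s : seq T) (F : T -> S) : ideal I ->
  (forall t, I (F t)) -> I (\sum_(t <- s) F t).
Proof.
move=> iI IF; elim/big_ind: _ => //; first by case: iI.
by move=> x y; exact: idealD.
Qed.

Lemma ideal_add I x : ideal I -> ideal [set y | exists a b, I b /\ y = a * x + b].
Proof.
move=> iI; split; first by exists 0, 0; rewrite mul0r addr0; split=> //; case: iI.
move=> a u v [c [d [Id ->]]] [c' [d' [Id' ->]]].
exists (a * c + c'), (a * d + d'); split; first by case: iI => _; exact.
by rewrite mulrDr mulrDl !mulrA addrACA.
Qed.

(** Missing all powers of [w] stands for being proper after localization at [w]; the case [w] = 1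
    yields maximal ideals. *)
Lemma ideal_avoiding I w : ideal I -> (forall k, ~ I (w ^+ k)) ->
  exists P, [/\ ideal P, I `<=` P, forall k, ~ P (w ^+ k) &
    forall J, ideal J -> P `<=` J -> (forall k, ~ J (w ^+ k)) -> J = P].
Proof.
move=> idI Iw.
pose Q J := J = set0 \/ [/\ ideal J, I `<=` J & forall k, ~ J (w ^+ k)].
have QI : Q I by right; split.
have [F sFQ totF|P [QP maxP]] := @Zorn_bigcup _ Q.
  have [F0|[J0 FJ0 J0n]] : (forall X, F X -> X = set0) \/
      exists2 X, F X & X <> set0.
    have [?|h] := pselect (exists2 X, F X & X <> set0); first by right.
    by left=> X FX; apply: contrapT => X0; apply: h; exists X.
    by left; apply/seteqP; split=> // x [X /F0 ->].
  have gd X : F X -> X !=set0 -> [/\ ideal X, I `<=` X & forall k, ~ X (w ^+ k)].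
    by move=> /sFQ[->[]//|].
  have ne J : J <> set0 -> J !=set0 by move/eqP/set0P.
  right; have [iJ0 sJ0 _] := gd _ FJ0 (ne _ J0n); split.
  - split; first by exists J0 => //; case: iJ0.
    move=> a u v [X FX Xu] [Y FY Yv].
    have [iX sX wX] := gd _ FX (ex_intro _ u Xu).
    have [iY sY wY] := gd _ FY (ex_intro _ v Yv).
    have [XY|YX] := totF _ _ FX FY.
      by exists Y => //; apply: iY.2 => //; exact: XY.
    by exists X => //; apply: iX.2 => //; exact: YX.
  - by move=> x Ix; exists J0 => //; exact: sJ0.
  - by move=> k [X FX Xw]; have [_ _ h] := gd _ FX (ex_intro _ _ Xw); exact: (h k).
case: QP => [P0|[idP IP Pw]].
  exfalso; apply: (maxP I) => //; rewrite P0; split=> // h.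
  by have := h 0; apply; case: idI.
exists P; split=> // J idJ PJ Jw; apply: contrapT => JP.
apply: (maxP J); last by right; split => // x /IP/PJ.
by split=> // JsP; apply: JP; apply/seteqP; split.
Qed.

Lemma avoiding_prime P w : ideal P -> (forall k, ~ P (w ^+ k)) ->
  (forall J, ideal J -> P `<=` J -> (forall k, ~ J (w ^+ k)) -> J = P) ->
  prime_ideal P.
Proof.
move=> idP Pw maxP; split=> //; first exact: (Pw 0).
move=> x y Pxy; apply: contrapT => /not_orP[Px Py].
have meet z : ~ P z -> exists k a b, P b /\ w ^+ k = a * z + b.
  move=> Pz; have [//|h] := pselect (exists k a b, P b /\ w ^+ k = a * z + b).
  exfalso; apply: Pz; rewrite -(maxP _ (ideal_add z idP)).
  - by exists 1, 0; rewrite mul1r addr0; split=> //; case: idP.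
  - by move=> b Pb; exists 0, b; rewrite mul0r add0r.
  - by move=> k [a [b ab]]; apply: h; exists k, a, b.
have [k [a [b [Pb Ek]]]] := meet _ Px; have [l [c [d [Pd El]]]] := meet _ Py.
apply: (Pw (k + l)%N); rewrite exprD Ek El mulrDl; apply: idealD => //.
  rewrite mulrDr; apply: idealD => //; last exact: idealM.
  by rewrite mulrACA; exact: idealM.
by rewrite mulrC; exact: idealM.
Qed.

Lemma field_point I w : ideal I -> (forall k, ~ I (w ^+ k)) ->
  exists (L : fieldType) (phi : {rmorphism S -> L}),
    (forall x, I x -> phi x = 0) /\ phi w != 0.
Proof.
move=> idI Iw; have [P [idP IP Pw maxP]] := ideal_avoiding idI Iw.
have [L [phi Ephi]] := prime_ideal_field (avoiding_prime idP Pw maxP).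
exists L, phi; split; first by move=> x /IP/Ephi.
by apply/eqP => /Ephi; exact: (Pw 1).
Qed.

Lemma powers_of_1_avoid I : ~ I 1 -> forall k, ~ I (1 ^+ k).
Proof. by move=> I1 k; rewrite expr1n. Qed.

Lemma maximal_over I : ideal I -> ~ I 1 -> exists2 m, maximal_ideal m & I `<=` m.
Proof.
move=> idI I1; have [P [idP IP Pw maxP]] := ideal_avoiding idI (powers_of_1_avoid I1).
exists P => //; split=> //; first exact: (Pw 0).
by move=> J idJ PJ J1; apply: maxP => //; exact: powers_of_1_avoid.
Qed.

Lemma maximal_prime m : maximal_ideal m -> prime_ideal m.
Proof.
case=> idm m1 maxm; apply: (@avoiding_prime _ 1) => //; first exact: powers_of_1_avoid.
by move=> J idJ mJ J1; apply: maxm => //; exact: (J1 0).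
Qed.

Lemma field_point_ideal I : ideal I -> ~ I 1 ->
  exists (L : fieldType) (phi : {rmorphism S -> L}), forall x, I x -> phi x = 0.
Proof.
move=> idI I1; have [L [phi [h _]]] := field_point idI (powers_of_1_avoid I1).
by exists L, phi.
Qed.

Lemma ideal_local I : ideal I ->
  (forall (L : fieldType) (phi : {rmorphism S -> L}),
     exists2 x, I x & phi x != 0) -> I 1.
Proof.
move=> idI h; apply: contrapT => I1; have [L [phi I0]] := field_point_ideal idI I1.
by have [x /I0 ->] := h L phi; rewrite eqxx.
Qed.

(** The local-global principle on the open set where [w] is nonzero: there I becomes the unit ideal
    once [w] is inverted. *)
Lemma ideal_local_power I w : ideal I ->
  (forall (L : fieldType) (phi : {rmorphism S -> L}), phi w != 0 ->
     exists2 x, I x & phi x != 0) -> exists k, I (w ^+ k).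
Proof.
move=> idI h; apply: contrapT => Iw.
have [k Ik|L [phi [I0 /h[x /I0 ->]]]] := @field_point I w idI.
  by apply: Iw; exists k.
by rewrite eqxx.
Qed.

Lemma unit_of_maximal x : (forall m, maximal_ideal m -> ~ m x) ->
  exists y, x * y = 1.
Proof.
move=> h; apply: contrapT => nx.
have id0 : ideal [set y : S | y = 0].
  by split=> // a u v -> ->; rewrite mulr0 addr0.
have [|m mm xm] := @maximal_over _ (ideal_add x id0).
  by case=> a [b [->]]; rewrite addr0 => E; apply: nx; exists a; rewrite mulrC.
by apply: (h m mm); apply: xm; exists 1, 0; rewrite mul1r addr0.
Qed.

Lemma annihilator_ideal z : ideal [set x : S | x * z = 0].
Proof.
split; first by rewrite /= mul0r.
by move=> a u v /= uz vz; rewrite mulrDl -mulrA uz vz mulr0 addr0.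
Qed.

End Zorn.

(** * Faithful flatness *)

Section Via.
Variables (C B : comNzRingType) (rho : {rmorphism C -> B}).
(** An alias of [B] indexed by [rho], on which C acts through [rho]. *)
Definition via of {rmorphism C -> B} : Type := B.
Local Notation V := (via rho).
HB.instance Definition _ := GRing.ComNzRing.on V.
Definition via_scale (c : C) (b : V) : V := (rho c : V) * b.
Fact via_scaleA a b v : via_scale a (via_scale b v) = via_scale (a * b) v.
Proof. by rewrite /via_scale rmorphM mulrA. Qed.
Fact via_scale1 : left_id 1 via_scale.
Proof. by move=> v; rewrite /via_scale rmorph1 mul1r. Qed.
Fact via_scaleDr : right_distributive via_scale +%R.
Proof. by move=> c u v; rewrite /via_scale mulrDr. Qed.
Fact via_scaleDl v : {morph via_scale^~ v : a b / a + b}.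
Proof. by move=> a b; rewrite /via_scale rmorphD mulrDl. Qed.
HB.instance Definition _ := GRing.Zmodule_isLmodule.Build C V
  via_scaleA via_scale1 via_scaleDr via_scaleDl.
Fact via_scaleAl (c : C) (u v : V) : c *: (u * v) = (c *: u) * v.
Proof. exact: mulrA. Qed.
HB.instance Definition _ := GRing.Lmodule_isLalgebra.Build C V via_scaleAl.
HB.instance Definition _ := GRing.Lalgebra_isComAlgebra.Build C V.

Lemma via_scaleE (c : C) (v : V) : c *: v = (rho c : V) * v.
Proof. by []. Qed.
End Via.

Section TensorApp.
Variables (C : comNzRingType) (M N V : lmodType C) (f : M -> N -> V).
Definition bilinear_fun of bilinear_for *:%R *:%R f := f.
Variable fP : bilinear_for *:%R *:%R f.
HB.instance Definition _ := bilinear_isBilinear.Build C M N V *:%R *:%R (bilinear_fun fP) fP.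

Lemma tensor_null_app (s : seq (M * N)) : tensor_null s ->
  \sum_(x <- s) f x.1 x.2 = 0.
Proof. by move=> h; exact: (h _ (bilinear_fun fP)). Qed.
End TensorApp.

Section FaithfullyFlat.
Variables (C : comNzRingType) (S : comAlgType C) (ffS : faithfully_flat S).

Definition extended_ideal (I : set C) : set S :=
  [set s | exists2 t : seq (C * S), (forall x, x \in t -> I x.1) &
     s = \sum_(x <- t) x.1 *: x.2].

Lemma extended_ideal_ideal I : ideal (extended_ideal I).
Proof.
split; first by exists [::]; rewrite ?big_nil.
move=> a u v [t tI ->] [t' t'I ->].
exists ([seq (x.1, a * x.2) | x <- t] ++ t').
  by move=> x; rewrite mem_cat => /orP[/mapP[y /tI Iy ->]|/t'I].
rewrite big_cat big_map mulr_sumr; congr (_ + _); apply: eq_bigr => x _.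
by rewrite scalerAr.
Qed.

Lemma sub_extended_ideal (I : set C) c : I c -> extended_ideal I c%:A.
Proof.
move=> Ic; exists [:: (c, 1)]; last by rewrite big_seq1.
by move=> x; rewrite inE => /eqP ->.
Qed.

(** If 1 were in I S, each pure tensor of C/I and S could be rewritten with coefficients from I,
    which move to the left factor and vanish there; faithfulness would then give C/I = 0. *)
Lemma extended_ideal_proper (I : set C) : ideal I -> ~ I 1 -> ~ extended_ideal I 1.
Proof.
move=> idI I1 [t tI Et]; apply: (I1).
pose Q := via (quotient_map idI I1).
apply/(quotient_map_eq0 idI I1 1); apply: (ffS.2 Q) => s V beta.
 rewrite big1_seq // => x _.
have -> : x.2 = \sum_(y <- t) y.1 *: (x.2 * y.2).
  rewrite -[LHS]mulr1 Et mulr_sumr.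
  by apply: eq_bigr => y _; rewrite scalerAr.
rewrite linear_sumr big1_seq // => y /andP[_ /tI Iy].
rewrite linearZr_LR -linearZl_LR via_scaleE /=.
by rewrite (quotient_map_eq0 idI I1 y.1).2 // mul0r linear0l.
Qed.

Lemma ff_point (I : set C) : ideal I -> ~ I 1 ->
  exists (L : fieldType) (phi : {rmorphism S -> L}), forall c, I c -> phi c%:A = 0.
Proof.
move=> idI I1; have := field_point_ideal (extended_ideal_ideal I).
case/(_ (extended_ideal_proper idI I1)) => L [phi h]; exists L, phi => c Ic.
exact/h/sub_extended_ideal.
Qed.

(** Points of S can replace points of C, because a proper ideal of C stays proper in S. This matters
    since A is split only over S. *)
Lemma ff_local (I : set C) : ideal I ->
  (forall (L : fieldType) (phi : {rmorphism S -> L}),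
     exists2 c, I c & phi c%:A != 0) -> I 1.
Proof.
move=> idI h; apply: contrapT => I1; have [L [phi I0]] := ff_point idI I1.
by have [x /I0 ->] := h L phi; rewrite eqxx.
Qed.

Section Injective.
Variables (c : C) (c0 : ~ [set x | x * c = 0] 1).
Local Notation pi := (quotient_map (annihilator_ideal c) c0).
Definition mult_quotient (q : via pi) : C^o :=
  projT1 (cid (quotient_map_surj (q : quotient (annihilator_ideal c) c0))) * c.

Lemma mult_quotientE x : mult_quotient (pi x) = x * c.
Proof.
rewrite /mult_quotient; case: cid => y /= yx; apply/eqP; rewrite -subr_eq0 -mulrBl.
by apply/eqP; apply/(quotient_map_eq0 (annihilator_ideal c) c0); rewrite rmorphB /= yx subrr.
Qed.

Fact mult_quotient_linear : linear mult_quotient.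
Proof.
move=> a u v; have [x <-] := quotient_map_surj u; have [y <-] := quotient_map_surj v.
rewrite via_scaleE -[X in mult_quotient (X + _)](rmorphM pi).
rewrite -[X in mult_quotient X](rmorphD pi) !mult_quotientE mulrDl.
by rewrite -mulrA.
Qed.
HB.instance Definition _ :=
  GRing.isLinear.Build C (via pi) C^o *:%R mult_quotient mult_quotient_linear.

Lemma mult_quotient_inj : injective mult_quotient.
Proof.
move=> u v; have [x <-] := quotient_map_surj u; have [y <-] := quotient_map_surj v.
rewrite !mult_quotientE => /eqP; rewrite -subr_eq0 -mulrBl => /eqP.
move/(quotient_map_eq0 (annihilator_ideal c) c0); rewrite rmorphB /= => /eqP.
by rewrite subr_eq0 => /eqP.
Qed.
End Injective.

(* Otherwise C / Ann(c) -> C, x |-> x c would stay injective after tensoring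
   with S, while c S = 0. *)
Lemma ff_inj (c : C) : c%:A = 0 :> S -> c = 0.
Proof.
move=> cA0; apply: contrapT => cn0.
have c0 : ~ [set x | x * c = 0] 1 by rewrite /= mul1r.
apply: (c0); apply/(quotient_map_eq0 (annihilator_ideal c) c0).
apply: (ffS.2 (via (quotient_map (annihilator_ideal c) c0))) => s.
have := ffS.1 (via (quotient_map (annihilator_ideal c) c0)) C^o (@mult_quotient c c0).
apply; first exact: mult_quotient_inj.
move=> V beta; rewrite big_map big1_seq // => x _ /=.
have [y <-] := quotient_map_surj x.1; rewrite mult_quotientE.
rewrite -[y * c]mulr1 -[_ * 1]/(_ *: (1 : C^o)) -scalerA linearZl_LR linearZl_LR.
rewrite -linearZr_LR -[x.2]mul1r scalerAl cA0 mul0r linear0r scaler0 //.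
Qed.
End FaithfullyFlat.

(** * Idempotent and cyclic matrices *)

Section DeterminantSwap.
Variables (S : comNzRingType) (n r : nat).

(** Sylvester's determinant identity for a scalar [a] that may be a zero divisor, whence the
    balancing powers. Both sides come from block elimination in the same matrix [X]. *)
Lemma det_add_mulmxC (a : S) (U : 'M[S]_(n, r)) (V : 'M[S]_(r, n)) :
  \det (a%:M + U *m V) * a ^+ r = a ^+ n * \det (a%:M + V *m U).
Proof.
pose X := block_mx (a%:M : 'M_n) (- U) V (1%:M : 'M_r).
have -> : \det (a%:M + U *m V) = \det X.
  have := congr1 determinant (mulmx_block (a%:M : 'M_n) (- U) V (1%:M : 'M_r)
    (1%:M : 'M_n) 0 (- V) (1%:M : 'M_r)).
  rewrite det_mulmx det_lblock !det1 !mulr1 => ->.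
  rewrite !(mulmx1, mulmx0, mul1mx, add0r) mulmxN !mulNmx opprK subrr.
  by rewrite det_ublock det1 mulr1.
have := congr1 determinant (mulmx_block (1%:M : 'M_n) 0 (- V) (a%:M : 'M_r)
  (a%:M : 'M_n) (- U) V (1%:M : 'M_r)).
rewrite det_mulmx det_lblock det1 mul1r det_scalar mulrC => ->.
rewrite !(mulmx1, mul0mx, mul1mx, addr0) mulmxN !mulNmx opprK.
rewrite mul_mx_scalar mul_scalar_mx addNr.
by rewrite det_ublock det_scalar [_ + a%:M]addrC.
Qed.
End DeterminantSwap.

(** A substitute for inverting N near a point: where [\det N] is nonzero, it is a local witness that
    D vanishes. *)
Lemma det_mulmx_annihilator (S : comNzRingType) n (N D : 'M[S]_n) :
  N *m D = 0 -> \det N *: D = 0.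
Proof.
by move=> ND; rewrite -mul_scalar_mx -mul_adj_mx -mulmxA ND mulmx0.
Qed.

Lemma idempotent_factor (L : fieldType) n (e : 'M[L]_n) : e *m e = e ->
  exists (r : nat) (B1 : 'M[L]_(n, r)) (B2 : 'M[L]_(r, n)),
    B1 *m B2 = e /\ B2 *m B1 = 1%:M.
Proof.
move=> ee; have := mulmx_base e.
have /row_freeP := row_base_free e; have /row_fullP := col_base_full e.
move: (col_base e) (row_base e) => B1 B2 [B1' B1K] [B2' B2K] EB.
exists (\rank e), B1, B2; split=> //.
have E : B1 *m (B2 *m B1) *m B2 = B1 *m B2 by rewrite mulmxA -mulmxA EB ee.
have := congr1 (fun M => B1' *m M *m B2') E.
by rewrite /= !mulmxA B1K !mul1mx -mulmxA B2K mulmx1.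
Qed.

Section Selection.
Variables (S : comNzRingType) (L : fieldType) (phi : {rmorphism S -> L}).

(* U and V come from a selected invertible r-minor of e at phi; the difference D
   below is, up to a factor, an idempotent vanishing at phi, hence it is killed by
   an element not vanishing at phi. *)
Lemma idempotent_local_basis n (e : 'M[S]_n) : e *m e = e ->
  exists (r : nat) (x : S) (U : 'M[S]_(n, r)) (V : 'M[S]_(r, n)),
    [/\ phi x != 0, U *m V = x *: e, V *m U = x%:M, e *m U = U & V *m e = V].
Proof.
move=> ee; pose eL := map_mx phi e; 
have eeL : eL *m eL = eL by rewrite -map_mxM ee.
have [r [B1 [B2 [EB BB]]]] := idempotent_factor eeL.
have f1 : row_full B1 by apply/row_fullP; exists B2.
have f2 : row_full B2^T by apply/row_fullP; exists B1^T; rewrite -trmx_mul BB trmx1.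
pose V0 : 'M[S]_(r, n) := rowsub (fullrankfun f1) 1%:M.
pose U0 : 'M[S]_(n, r) := (rowsub (fullrankfun f2) 1%:M)^T.
have uV : map_mx phi V0 *m B1 \in unitmx.
  have -> : map_mx phi V0 *m B1 = rowsub (fullrankfun f1) B1.
    rewrite [RHS]rowsubE; congr (_ *m _); apply/matrixP=> i j.
    by rewrite !mxE rmorphMn rmorph1.
  exact: fullrowsub_unit.
have uU : B2 *m map_mx phi U0 \in unitmx.
  rewrite -unitmx_tr trmx_mul.
  have -> : (map_mx phi U0)^T *m B2^T = rowsub (fullrankfun f2) B2^T.
    rewrite [RHS]rowsubE; congr (_ *m _); apply/matrixP=> i j.
    by rewrite !mxE rmorphMn rmorph1.
  exact: fullrowsub_unit.
have [U EU] : {U | U = e *m U0} by exists (e *m U0).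
have [V EV] : {V | V = V0 *m e} by exists (V0 *m e).
have [H EH] : {H | H = V *m U} by exists (V *m U).
have [Z EZ] : {Z | Z = U *m \adj H *m V} by exists (U *m \adj H *m V).
pose h := \det H.
pose D := h *: e - Z; pose x0 := \det (h%:M - D).
have HE : V0 *m e *m U0 = H by rewrite EH EV EU -!mulmxA (mulmxA e e) ee.
have HL : map_mx phi H = (map_mx phi V0 *m B1) *m (B2 *m map_mx phi U0).
  by rewrite -HE !map_mxM -/eL -EB !mulmxA.
have h0 : phi h != 0.
  rewrite -det_map_mx HL det_mulmx mulf_neq0 // -unitfE -?unitmxE //.
have eZ : e *m Z = Z by rewrite EZ EU !mulmxA ee.
have Ze : Z *m e = Z by rewrite EZ EV -!mulmxA ee.
have ZZ : Z *m Z = h *: Z.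
  rewrite EZ !mulmxA -(mulmxA _ V U) -EH -(mulmxA U) mul_adj_mx.
  by rewrite -/h mul_mx_scalar -!scalemxAl.
have DD : (h%:M - D) *m D = 0.
  rewrite mulmxBl mul_scalar_mx; apply/eqP; rewrite subr_eq0; apply/eqP.
  rewrite /D mulmxBl !mulmxBr -!scalemxAl -!scalemxAr ee eZ Ze ZZ.
  by rewrite subrr subr0 scalerBr.
have DL : map_mx phi D = 0.
  have QP : (B2 *m map_mx phi U0) *m map_mx phi (\adj H) *m (map_mx phi V0 *m B1) =
      (phi h)%:M.
    apply: (can_inj (mulKmx uV)); rewrite !mulmxA -(mulmxA _ B2) -(mulmxA _ _ B1).
    rewrite -HL -map_mxM mul_mx_adj -/h map_scalar_mx mul_scalar_mx.
    by rewrite mul_mx_scalar.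
  rewrite /D map_mxB map_mxZ -/eL EZ EU EV !map_mxM -/eL -EB.
  set X := (X in _ - X = _).
  have -> : X = B1 *m ((B2 *m map_mx phi U0) *m map_mx phi (\adj H) *m
      (map_mx phi V0 *m B1)) *m B2 by rewrite /X !mulmxA.
  by rewrite QP mul_mx_scalar -scalemxAl subrr.
have x00 : phi x0 != 0.
  rewrite -det_map_mx map_mxB DL subr0 map_scalar_mx det_scalar.
  by rewrite expf_neq0.
have x0D : x0 *: D = 0 by exact: det_mulmx_annihilator.
exists r, (x0 * h), (x0 *: (U *m \adj H)), V; split.
- by rewrite rmorphM mulf_neq0.
- rewrite -scalemxAl -EZ; apply/eqP; rewrite -scalerA eq_sym -subr_eq0 -scalerBr.
  by apply/eqP.
- by rewrite -scalemxAr mulmxA -EH mul_mx_adj -/h scale_scalar_mx.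
- by rewrite -scalemxAr !mulmxA EU mulmxA ee.
- by rewrite EV -mulmxA ee.
Qed.
End Selection.

(** * Cayley-Hamilton and determinants on the image of an idempotent *)

Section LocalCayleyHamilton.
Variables (S : comNzRingType) (n r : nat) (e : 'M[S]_n) (x : S).
Variables (U : 'M[S]_(n, r.+1)) (V : 'M[S]_(r.+1, n)).
Hypotheses (UV : U *m V = x *: e) (VU : V *m U = x%:M).
Variables (y : 'M[S]_n) (P : nat -> 'M[S]_n).
Hypotheses (P0 : P 0%N = e) (PS : forall k, P k.+1 = P k *m y).
Hypotheses (ey : e *m y = y) (ye : y *m e = y).
Local Notation Y := (V *m y *m U).

Lemma local_power k : U *m (Y ^+ k) *m V = x ^+ k.+1 *: P k.
Proof.
elim: k => [|k IHk]; first by rewrite expr0 mulmx1 expr1 P0.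
rewrite exprSr -mulmxE !mulmxA IHk -!scalemxAl -mulmxA UV -!scalemxAr scalerA.
by rewrite -exprSr PS -mulmxA ye.
Qed.

(** [U] and [V] identify im e with a free module only up to the factor [x]. Pulling back the
    characteristic equation of [Y] therefore leaves powers of [x], which cannot be divided out.
    [P k] plays the role of y^k with [e] as unit. *)
Lemma local_Cayley_Hamilton :
  \sum_(k < r.+2) ((char_poly Y)`_k * x ^+ k.+1) *: P k = 0.
Proof.
have /(congr1 (fun M => U *m M *m V)) := Cayley_Hamilton Y.
have := size_char_poly Y; move: (char_poly Y) => chi sz_chi.
rewrite mulmx0 mul0mx /= => E; rewrite -[RHS]E.
rewrite -[chi in RHS]coefK poly_def rmorph_sum sz_chi.
rewrite mulmx_sumr mulmx_suml; apply: eq_bigr => k _.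
rewrite /= horner_mxZ rmorphXn /= horner_mx_X -scalemxAr -scalemxAl local_power.
by rewrite scalerA.
Qed.

Lemma local_det :
  x ^+ (n.*2 + r.+1.*2) * \det (y + (1%:M - e)) = x ^+ (n.*2 + r.+1) * \det Y.
Proof.
(* The scalar is x^2 because U (Y - x) V = x^2 (y - e), so adding x^2 produces the determinant
   extended by the identity on the complement of im e. *)
have := det_add_mulmxC (x ^+ 2) (U *m (Y - x%:M)) V.
have -> : (x ^+ 2)%:M + U *m (Y - x%:M) *m V = x ^+ 2 *: (y + (1%:M - e)).
  rewrite mulmxBr mulmxBl mul_mx_scalar -scalemxAl UV !mulmxA UV -!scalemxAl ey.
  rewrite -mulmxA UV -scalemxAr ye !scalerA -expr2 scalerDr scalerBr scalemx1.
  by rewrite addrCA.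
have -> : (x ^+ 2)%:M + V *m (U *m (Y - x%:M)) = x *: Y.
  rewrite mulmxA VU mul_scalar_mx scalerBr scale_scalar_mx -expr2.
  by rewrite addrC subrK.
rewrite !detZ -!exprM mulrAC -exprD !mul2n => ->.
by rewrite mulrA -exprD.
Qed.
End LocalCayleyHamilton.

(** * Cyclic matrices and generic points *)

Section Regular.
Variable r : nat.

(* Invertible exactly when row 0 of the identity is a cyclic vector of Y. *)
Definition regular_mx (S : comNzRingType) (Y : 'M[S]_r.+1) : 'M[S]_r.+1 :=
  \matrix_(k, j) (Y ^+ k) 0 j.

Lemma map_regular_mx (S T : comNzRingType) (h : {rmorphism S -> T}) (Y : 'M_r.+1) :
  map_mx h (regular_mx Y) = regular_mx (map_mx h Y).
Proof. by apply/matrixP=> k j; rewrite !mxE -rmorphXn !mxE. Qed.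

(** The nilpotent shift: row 0 of its powers runs through the standard basis, so it witnesses that
    being cyclic is not an empty condition. *)
Definition shift_mx (S : comNzRingType) : 'M[S]_r.+1 :=
  \matrix_(k, j) (j == k.+1 :> nat)%:R.

Lemma regular_shift_mx (S : comNzRingType) : regular_mx (shift_mx S) = 1%:M.
Proof.
apply/matrixP=> k j; rewrite !mxE eq_sym -val_eqE /= eq_sym.
case: k => k /= lt_kr; elim: k lt_kr j => [|k IHk] lt_kr j.
  by rewrite expr0 mxE -val_eqE.
have sE i : shift_mx S i j = (j == i.+1 :> nat)%:R by rewrite mxE.
have lt_k := ltnW lt_kr; rewrite exprSr -mulmxE mxE (bigD1 (Ordinal lt_k)) //=.
rewrite IHk // sE /= eqxx mul1r big1 ?addr0 => [|l]; first by rewrite eq_sym.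
by rewrite -val_eqE /= => lk; rewrite IHk // eq_sym (negPf lk) mul0r.
Qed.
End Regular.

Section Generic.
Variable (L : fieldType).

(** Polynomiality along lines is all that genericity arguments use, since points are moved in one
    direction at a time. *)
Definition polynomial_on_lines (V : lmodType L) (g : V -> L) :=
  forall v0 v1, exists p : {poly L}, forall t, g (v0 + t *: v1) = p.[t].

Section Infinite.
Variables (C : nzRingType) (K : {rmorphism C -> L}).
Hypothesis Kinf : forall k, exists2 s : seq C, size s = k & uniq (map K s).

Lemma nonroot (p : {poly L}) : p != 0 -> exists c, p.[K c] != 0.
Proof.
move=> p0; have [s sz_s us] := Kinf (size p); apply: contrapT => h.
suff rts : all (root p) (map K s).
  by have := max_poly_roots p0 rts us; rewrite size_map sz_s ltnn.
apply/allP => _ /mapP[c _ ->]; apply/rootP/eqP; apply: contraT => ?.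
by case: h; exists c.
Qed.

Lemma polynomial_on_linesM (V : lmodType L) (g h : V -> L) :
  polynomial_on_lines g -> polynomial_on_lines h ->
  polynomial_on_lines (fun v => g v * h v).
Proof.
move=> gP hP v0 v1; have [p Ep] := gP v0 v1; have [q Eq] := hP v0 v1.
by exists (p * q) => t; rewrite Ep Eq hornerM.
Qed.

Lemma polynomial_nonzeroM (V : lmodType L) (g h : V -> L) :
  polynomial_on_lines g -> polynomial_on_lines h ->
  (exists v, g v != 0) -> (exists v, h v != 0) -> exists v, g v * h v != 0.
Proof.
move=> gP hP [v gv] [w hw]; have [p Ep] := gP v (w - v); have [q Eq] := hP v (w - v).
have p0 : p != 0.
  by apply: contraNneq gv => p0; rewrite -[v]addr0 -(scale0r (w - v)) Ep p0 horner0.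
have q0 : q != 0.
  apply: contraNneq hw => q0; have := Eq 1.
  by rewrite scale1r addrC subrK q0 horner0 => ->.
have [c] := nonroot (mulf_neq0 p0 q0); rewrite hornerM -Ep -Eq => ?.
by exists (v + K c *: (w - v)).
Qed.

(* The coordinates of a nonzero point over L are moved into the image of C
   one at a time. *)
Lemma generic_point (V : lmodType L) (A : lmodType C) (G : A -> V) (g : V -> L) :
  (forall c a b, G (c *: a + b) = K c *: G a + G b) ->
  (forall v, exists s : seq (A * L), v = \sum_(x <- s) x.2 *: G x.1) ->
  polynomial_on_lines g -> (exists v, g v != 0) -> exists a, g (G a) != 0.
Proof.
move=> GP Gspan gP [v gv]; have [s Es] := Gspan v.
have G0 : G 0 = 0.
  have := GP 1 0 0; rewrite scaler0 addr0 rmorph1 scale1r => E.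
  by apply: (addrI (G 0)); rewrite -E addr0.
suff h a0 : g (G a0 + \sum_(x <- s) x.2 *: G x.1) != 0 -> exists a, g (G a) != 0.
  by apply: (h 0); rewrite G0 add0r -Es.
elim: s {Es} a0 => [|x s IHs] a0; first by rewrite big_nil addr0; exists a0.
rewrite big_cons addrCA addrC => gx.
have [p Ep] := gP (G a0 + \sum_(x <- s) x.2 *: G x.1) (G x.1).
have p0 : p != 0 by apply: contraNneq gx => p0; rewrite Ep p0 horner0.
have [c pc] := nonroot p0; apply: (IHs (c *: x.1 + a0)).
by rewrite GP -addrA addrC Ep.
Qed.
End Infinite.

Lemma polynomial_on_lines_det (n : nat) (V : lmodType L) (M : V -> 'M[L]_n)
  (N : V -> V -> 'M[{poly L}]_n) :
  (forall v0 v1 t, map_mx (horner_eval t) (N v0 v1) = M (v0 + t *: v1)) ->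
  polynomial_on_lines (fun v => \det (M v)).
Proof.
move=> NP v0 v1; exists (\det (N v0 v1)) => t.
by rewrite -NP det_map_mx.
Qed.

Definition line_mx m n (Y0 Y1 : 'M[L]_(m, n)) : 'M[{poly L}]_(m, n) :=
  map_mx polyC Y0 + 'X *: map_mx polyC Y1.

Lemma map_line_mx m n (Y0 Y1 : 'M[L]_(m, n)) t :
  map_mx (horner_eval t) (line_mx Y0 Y1) = Y0 + t *: Y1.
Proof.
by apply/matrixP=> i j; rewrite !mxE /horner_eval !hornerE.
Qed.

(** [B] is to be the matrix of a unit b, so that both y and b y become cyclic. The factor [\det Y]
    will make the functional of [end_functional] nonzero at y^(r+1). *)
Lemma regular_exists r (C : nzRingType) (K : {rmorphism C -> L}) (B : 'M[L]_r.+1) :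
  (forall k, exists2 s : seq C, size s = k & uniq (map K s)) ->
  B \in unitmx ->
  let g Y := \det Y * (\det (regular_mx Y) * \det (regular_mx (B *m Y))) in
  polynomial_on_lines g /\ exists Y, g Y != 0.
Proof.
move=> Kinf uB g.
have p1 : polynomial_on_lines (fun Y : 'M[L]_r.+1 => \det Y).
  by apply: (polynomial_on_lines_det (N := @line_mx _ _)) => *; rewrite map_line_mx.
have p2 : polynomial_on_lines (fun Y : 'M[L]_r.+1 => \det (regular_mx Y)).
  apply: (polynomial_on_lines_det (N := fun Y Z => regular_mx (line_mx Y Z))) => *.
  by rewrite map_regular_mx map_line_mx.
have p3 : polynomial_on_lines (fun Y : 'M[L]_r.+1 => \det (regular_mx (B *m Y))).
  apply: (polynomial_on_lines_det
    (N := fun Y Z => regular_mx (map_mx polyC B *m line_mx Y Z))) => *.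
  rewrite map_regular_mx map_mxM map_line_mx -map_mx_comp map_mx_id //.
  by move=> c; rewrite /= /horner_eval hornerC.
have p23 := polynomial_on_linesM p2 p3.
split; first exact: polynomial_on_linesM.
apply: (polynomial_nonzeroM Kinf p1 p23); first by exists 1%:M; rewrite det1 oner_neq0.
apply: (polynomial_nonzeroM Kinf p2 p3).
  by exists (shift_mx r L); rewrite regular_shift_mx det1 oner_neq0.
by exists (invmx B *m shift_mx r L); rewrite mulKVmx // regular_shift_mx det1 oner_neq0.
Qed.
End Generic.

(** * Splittings at a field-valued point *)

Definition split_det (C : comNzRingType) (A : algType C) (S : comAlgType C) (n : nat)
    (f : A -> 'M[S]_n) (a : A) : S := \det (f a + (1%:M - f 1)).

Definition linear_functional (C : comNzRingType) (A : lmodType C) (mu : A -> C) :=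
  forall c a b, mu (c *: a + b) = c * mu a + mu b.

Section Splitting.
Variables (C : comNzRingType) (A : algType C) (S : comAlgType C) (n : nat).
Variable (f : A -> 'M[S]_n).

(* The specialization of the split algebra at a field-valued point phi of S,
   written as a full matrix algebra of size r.+1. *)
Record split_point (L : fieldType) (phi : {rmorphism S -> L}) (r : nat)
    (G : A -> 'M[L]_r.+1) : Prop := SplitPoint {
  pt_linear : forall c a b, G (c *: a + b) = phi c%:A *: G a + G b;
  pt_mul : forall a b, G (a * b) = G a *m G b;
  pt_one : G 1 = 1%:M;
  pt_det : forall a, phi (split_det f a) = \det (G a);
  pt_span : forall Y, exists s : seq (A * L), Y = \sum_(x <- s) x.2 *: G x.1;
  pt_coord : forall N (i : {linear A -> 'rV[C]_N}),
    exists beta, forall a, mxvec (G a) *m beta = map_mx (phi \o GRing.in_alg S) (i a);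
  pt_relation : forall y mu, linear_functional mu ->
    (forall k, (0 < k <= r)%N -> mu (y ^+ k) = 0) ->
    exists2 x, phi x != 0 &
      x * ((mu (y ^+ r.+1))%:A + (-1) ^+ r.+1 * split_det f y * (mu 1)%:A) = 0 }.

Hypothesis fP : splitting f.

Lemma splittingD a b : f (a + b) = f a + f b.
Proof. by case: fP => h _ _ _; rewrite -[a in LHS]scale1r h !scale1r. Qed.

Lemma splitting0 : f 0 = 0.
Proof. by apply: (addrI (f 0)); rewrite -splittingD !addr0. Qed.

Lemma splittingM a b : f (a * b) = f a *m f b.
Proof. by case: fP. Qed.

Lemma splittingZ c a : f (c *: a) = c%:A *: f a.
Proof. by case: fP => h _ _ _; rewrite -[c *: a]addr0 h splitting0 addr0. Qed.

Lemma split_det1 : split_det f 1 = 1.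
Proof. by rewrite /split_det addrC subrK det1. Qed.

Lemma split_detM a b : split_det f (a * b) = split_det f a * split_det f b.
Proof.
have h c : (1%:M - f 1) *m f c = 0.
  by rewrite mulmxBl mul1mx -splittingM mul1r subrr.
have h' c : f c *m (1%:M - f 1) = 0.
  by rewrite mulmxBr mulmx1 -splittingM mulr1 subrr.
have h1 : (1%:M - f 1) *m (1%:M - f 1) = 1%:M - f 1 by rewrite mulmxBr mulmx1 h subr0.
rewrite /split_det -det_mulmx; move: (1%:M - f 1) h h' h1 => g h h' h1.
by rewrite mulmxDr !mulmxDl -splittingM h h' addr0 add0r h1.
Qed.

(** Injectivity of the map from the scalar extension of A to End(P) lets a C-linear functional on A
    extend S-linearly to the matrices spanned by [f]. *)
Lemma splitting_injective (lam : A -> C) (T : seq (A * S)) :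
  linear_functional lam -> \sum_(x <- T) x.2 *: f x.1 = 0 ->
  \sum_(x <- T) lam x.1 *: x.2 = 0.
Proof.
move=> lamP T0; case: fP => _ _ _ /(_ T T0) null.
apply: (@tensor_null_app _ _ _ _ (fun a (s : S) => lam a *: s)) null.
split=> [s c a b|a c s t] /=; first by rewrite lamP scalerDl scalerA.
by rewrite scalerDr !scalerA mulrC.
Qed.

Lemma splitting_coord N (i : {linear A -> 'rV[C]_N}) :
  exists beta, forall a, mxvec (f a) *m beta = map_mx (GRing.in_alg S) (i a).
Proof.
have [_ _ surj _] := fP.
have ff : f 1 *m f 1 = f 1 by rewrite -splittingM mulr1.
have /choice[s sP] (q : 'I_(n * n)) : exists s : seq (A * S),
    f 1 *m vec_mx (delta_mx 0 q) *m f 1 = \sum_(x <- s) x.2 *: f x.1.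
  by apply: surj; rewrite !mulmxA ff -mulmxA ff.
exists (\matrix_(q, j) \sum_(x <- s q) i x.1 0 j *: x.2) => a.
have [c Ec] : {c | c = mxvec (f a)} by exists (mxvec (f a)).
apply/rowP => j; rewrite -Ec !mxE.
(* [T] is the formal relation between [a] and the expansion of [f a] along matrix units compressed
   by [f 1]; applying a coordinate of [i] to it gives the column of beta. *)
pose T := (a, - 1 : S) :: flatten [seq [seq (x.1, c 0 q * x.2) | x <- s q]
   | q <- index_enum 'I_(n * n)].
have T0 : \sum_(x <- T) x.2 *: f x.1 = 0.
  rewrite big_cons /= scaleN1r big_flatten big_map /=.
  have -> : f a = f 1 *m vec_mx c *m f 1.
    by rewrite Ec mxvecK -!splittingM mulr1 mul1r.
  rewrite [c]row_sum_delta linear_sum mulmx_sumr mulmx_suml.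
  rewrite addrC; apply/eqP; rewrite subr_eq0; apply/eqP; apply: eq_bigr => q _.
  rewrite linearZ /= -scalemxAr -scalemxAl sP big_map scaler_sumr.
  by apply: eq_bigr => x _; rewrite scalerA -row_sum_delta.
have lamP : linear_functional (fun a => i a 0 j).
  by move=> l b d; rewrite linearP !mxE.
have := splitting_injective lamP T0.
rewrite big_cons /= big_flatten big_map scalerN => /eqP.
rewrite addrC subr_eq0 => /eqP <-; apply: eq_bigr => q _.
rewrite mxE mulr_sumr big_map; apply: eq_bigr => x _ /=.
by rewrite scalerAr.
Qed.

Lemma split_relation (r : nat) (x : S) (U : 'M[S]_(n, r.+1)) (V : 'M[S]_(r.+1, n))
    (y : A) (mu : A -> C) :
  U *m V = x *: f 1 -> V *m U = x%:M -> linear_functional mu ->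
  (forall k, (0 < k <= r)%N -> mu (y ^+ k) = 0) ->
  x ^+ (n.*2 + r.+1.*2) *
    ((mu (y ^+ r.+1))%:A + (-1) ^+ r.+1 * split_det f y * (mu 1)%:A) = 0.
Proof.
move=> UV VU muP mu0; pose Y := V *m f y *m U.
have ey : f 1 *m f y = f y by rewrite -splittingM mul1r.
have ye : f y *m f 1 = f y by rewrite -splittingM mulr1.
have PS k : f (y ^+ k.+1) = f (y ^+ k) *m f y by rewrite exprSr splittingM.
have := local_Cayley_Hamilton UV (P := fun k => f (y ^+ k)) erefl PS ye.
have := local_det UV VU ey ye; rewrite -/Y -[\det (_ + _)]/(split_det f y) => Edet.
have chi0 := char_poly_det Y; have := char_poly_monic Y.
rewrite monicE lead_coefE size_char_poly /=.
move: (char_poly Y) chi0 => chi chi0 /eqP chiS CH.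
pose T := [seq (y ^+ k, chi`_k * x ^+ k.+1) | k : 'I_r.+2 <- index_enum 'I_r.+2].
have := @splitting_injective mu T muP; rewrite /T !big_map => /(_ CH) /=.
rewrite big_ord_recl big_ord_recr /= big1 ?add0r => [|k _]; last first.
  by rewrite mu0 ?scale0r //= /bump /= add1n ltn_ord.
(* Only the constant and leading terms survive [mu]. The factor x^(2n+r) raises the leading one to
   x^(2n+2(r+1)) and the constant one to x^(2n+r+1) \det Y, the form that [local_det] converts. *)
rewrite /bump /= add1n expr0 expr1 chi0 chiS mul1r => /(congr1 ( *%R (x ^+ (n.*2 + r)))).
rewrite mulr0 => <-; rewrite addrC !mulrDr; congr (_ + _).
  rewrite -[in RHS]mulr_algl; move: Edet; rewrite addnS exprSr => Edet.
  transitivity (x ^+ (n.*2 + r.+1.*2) * split_det f y * ((-1) ^+ r.+1 * (mu 1)%:A)).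
    by ring.
  by rewrite Edet; ring.
rewrite -[in RHS]mulr_algl mulrC [in RHS]mulrCA -exprD; congr (_ * x ^+ _).
by rewrite -[(r.+1).*2]addnn !addnS !addnA.
Qed.

Hypothesis Afaithful : forall c : C, (forall a : A, c *: a = 0) -> c = 0.
Hypothesis Aproj : fg_projective A.

Lemma split_point_exists (L : fieldType) (phi : {rmorphism S -> L}) :
  exists r (G : A -> 'M[L]_r.+1), split_point phi G.
Proof.
have ff : f 1 *m f 1 = f 1 by rewrite -splittingM mulr1.
have [r [x [U [V [x0 UV VU eU Ve]]]]] := idempotent_local_basis phi ff.
pose G a := (phi x)^-1 *: map_mx phi (V *m f a *m U).
have VfU a b : (V *m f a *m U) *m (V *m f b *m U) = x *: (V *m f (a * b) *m U).
  rewrite !mulmxA -(mulmxA _ U V) UV -!scalemxAr -!scalemxAl; congr (_ *: _).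
  by rewrite -(mulmxA _ (f a)) -splittingM mulr1 -(mulmxA _ (f a)) -splittingM.
have UGV a : map_mx phi (f a) = (phi x)^-1 *: (map_mx phi U *m G a *m map_mx phi V).
  rewrite /G -scalemxAr -scalemxAl -!map_mxM !mulmxA UV -!scalemxAl -!mulmxA UV.
  rewrite -!scalemxAr -!splittingM mul1r mulr1 !map_mxZ !scalerA.
  by rewrite mulVf // mul1r mulVf // scale1r.
have Glin c u v : G (c *: u + v) = phi c%:A *: G u + G v.
  rewrite /G splittingD splittingZ mulmxDr mulmxDl -scalemxAr -scalemxAl map_mxD.
  by rewrite map_mxZ scalerDr !scalerA mulrC.
have Gmul a b : G (a * b) = G a *m G b.
  rewrite /G -scalemxAr -scalemxAl -map_mxM VfU map_mxZ !scalerA.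
  by rewrite -mulrA mulVf // mulr1.
have Gone : G 1 = 1%:M.
  by rewrite /G Ve VU map_scalar_mx scale_scalar_mx mulVf.
have Gcoord N (i : {linear A -> 'rV[C]_N}) :
    exists beta, forall a, mxvec (G a) *m beta = map_mx (phi \o GRing.in_alg S) (i a).
  have [beta betaP] := splitting_coord i.
  pose h : {linear 'M[L]_r -> 'M[L]_n} := mulmxr (map_mx phi V) \o mulmx (map_mx phi U).
  exists ((phi x)^-1 *: (lin_mx h *m map_mx phi beta)) => a.
  rewrite -scalemxAr mulmxA mul_vec_lin scalemxAl -linearZ -UGV map_mx_comp -betaP.
  by rewrite map_mxM map_mxvec.
case: r U V UV VU eU Ve @G VfU UGV Glin Gmul Gone Gcoord => [|r] U V UV VU eU Ve G
  VfU UGV Glin Gmul Gone Gcoord.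
  (* Degree zero is impossible: all coordinates of A would vanish at phi, so [\det M] would map to
     1, whereas it kills A and hence is 0 by faithfulness. *)
  have [N [i [p ipK]]] := Aproj; have [beta betaP] := Gcoord N i.
  pose M := 1%:M - lin1_mx (i \o p).
  have iM a : i a *m M = 0 by rewrite mulmxBr mulmx1 mul_rV_lin1 /= ipK subrr.
  have D0 : \det M = 0.
    apply: Afaithful => a; apply: (can_inj ipK); rewrite linear0 linearZ /=.
    by rewrite -mul_mx_scalar -mul_mx_adj mulmxA iM mul0mx.
  have /eqP := congr1 (phi \o GRing.in_alg S) D0.
  rewrite rmorph0 -det_map_mx map_mxB map_mx1.
  have -> : map_mx (phi \o GRing.in_alg S) (lin1_mx (i \o p)) = 0.
    apply/row_matrixP => j; rewrite row0 -map_row rowE mul_rV_lin1 /= -betaP.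
    by rewrite [mxvec _]thinmx0 mul0mx.
  by rewrite subr0 det1 oner_eq0.
exists r, G; split=> //.
- move=> a; apply: (mulfI (expf_neq0 (n.*2 + r.+1.*2) x0)).
  have ey : f 1 *m f a = f a by rewrite -splittingM mul1r.
  have ye : f a *m f 1 = f a by rewrite -splittingM mulr1.
  rewrite -rmorphXn -rmorphM (local_det UV VU ey ye) rmorphM rmorphXn.
  rewrite /G detZ det_map_mx mulrA exprVn; congr (_ * _).
  by rewrite rmorphXn -[r.+1.*2]addnn addnA [in RHS]exprD mulfK // expf_neq0.
- move=> Y; have [_ _ surj _] := fP.
  have Gsum (T : seq (A * S)) : \sum_(t <- T) phi t.2 *: G t.1 =
      (phi x)^-1 *: map_mx phi (V *m (\sum_(t <- T) t.2 *: f t.1) *m U).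
    rewrite mulmx_sumr mulmx_suml raddf_sum scaler_sumr; apply: eq_bigr => t _.
    by rewrite /G -scalemxAr -scalemxAl /= map_mxZ !scalerA mulrC.
  have Gdelta k l : exists s : seq (A * L), delta_mx k l = \sum_(t <- s) t.2 *: G t.1.
    have [|s Es] := surj (U *m delta_mx k l *m V).
      apply: (etrans _ (_ : f 1 *m U *m delta_mx k l *m (V *m f 1) = _)).
        by rewrite !mulmxA.
      by rewrite eU Ve.
    exists [seq (t.1, (phi x)^-1 * phi t.2) | t <- s]; rewrite big_map /=.
    under eq_bigr do rewrite -scalerA.
    rewrite -scaler_sumr Gsum -Es !mulmxA VU mul_scalar_mx -!scalemxAl -mulmxA VU.
    rewrite mul_mx_scalar !map_mxZ !scalerA map_delta_mx.
    by rewrite -[LHS]scale1r; congr (_ *: _); field.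
  have /choice[s sP] (kl : 'I_r.+1 * 'I_r.+1) : exists s : seq (A * L),
    delta_mx kl.1 kl.2 = \sum_(t <- s) t.2 *: G t.1 by exact: Gdelta.
  exists (flatten [seq [seq (t.1, Y kl.1 kl.2 * t.2) | t <- s kl]
    | kl <- index_enum ('I_r.+1 * 'I_r.+1)%type]).
  rewrite big_flatten big_map [LHS]matrix_sum_delta pair_big /=.
  apply: eq_bigr => kl _; rewrite sP scaler_sumr big_map.
  by apply: eq_bigr => t _; rewrite scalerA.
- by move=> y mu muP mu0; exists (x ^+ (n.*2 + r.+1.*2));
    [rewrite rmorphXn expf_neq0 | exact: split_relation UV VU muP mu0].
Qed.
End Splitting.

(** * Determinants of endomorphisms of A and the locus of a given degree *)

Section Presentation.
Variables (C : comNzRingType) (A : algType C) (N : nat).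
Variables (i : {linear A -> 'rV[C]_N}) (p : {linear 'rV[C]_N -> A}).

(* The determinant of T on the projective module A, computed after extending T
   by the identity on a complement of A in 'rV_N. *)
Definition endo_det (T : {linear A -> A}) : C :=
  \det (1%:M + (lin1_mx (i \o T \o p) - lin1_mx (i \o p))).

(* det (X on A + 1 on the complement), that is X^d where A has rank d. *)
Definition rank_poly : {poly C} :=
  \det (1%:M + ('X - 1) *: map_mx polyC (lin1_mx (i \o p))).

(** An indicator in C of the locus where A has degree r+1: it takes the value 1 at such points and 0
    at all others. *)
Definition rank_coef (r : nat) : C := rank_poly`_(r.+1 * r.+1).

Hypothesis ipK : cancel i p.

Lemma endo_det_bijective (T : {linear A -> A}) d :
  d * endo_det T = 1 -> (forall a, T a = 0 -> a = 0) /\ (forall b, exists a, T a = b).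
Proof.
rewrite /endo_det; set M := 1%:M + _ => dM.
have ME u : u *m M = u + (i (T (p u)) - i (p u)).
  by rewrite mulmxDr mulmx1 mulmxBr !mul_rV_lin1.
have adjK u : u *m (d *: \adj M) *m M = u.
  by rewrite -mulmxA -scalemxAl mul_adj_mx scale_scalar_mx dM mulmx1.
have Madj u : u *m M *m (d *: \adj M) = u.
  by rewrite -mulmxA -scalemxAr mul_mx_adj scale_scalar_mx dM mulmx1.
split=> [a Ta|b].
  apply: (can_inj ipK); rewrite -(Madj _ (i a)) ME ipK Ta linear0 sub0r subrr.
  by rewrite mul0mx.
exists (p (i b *m (d *: \adj M))); have := ME (i b *m (d *: \adj M)).
move/(congr1 p); rewrite adjK linearD linearB !ipK => E.
by rewrite [RHS]E addrC subrK.
Qed.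

Section AtPoint.
Variables (S : comAlgType C) (n : nat) (f : A -> 'M[S]_n).
Variables (L : fieldType) (phi : {rmorphism S -> L}) (r : nat).
Variable (G : A -> 'M[L]_r.+1).
Hypothesis GP : split_point f phi G.
Local Notation K := (phi \o GRing.in_alg S).

Lemma pt0 : G 0 = 0.
Proof.
have := pt_linear GP 1 0 0; rewrite scaler0 addr0 scale1r rmorph1 scale1r => E.
by apply: (addrI (G 0)); rewrite -E addr0.
Qed.

Lemma ptD a b : G (a + b) = G a + G b.
Proof. by rewrite -[a in LHS]scale1r (pt_linear GP) scale1r rmorph1 scale1r. Qed.

Lemma ptZ c a : G (c *: a) = K c *: G a.
Proof. by rewrite -[_ *: _ in LHS]addr0 (pt_linear GP) pt0 addr0. Qed.

Lemma ptX a k : G (a ^+ k) = G a ^+ k.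
Proof.
elim: k => [|k IHk]; first by rewrite !expr0 (pt_one GP).
by rewrite !exprS (pt_mul GP) IHk.
Qed.

(** The two matrices identify the matrix algebra over L with the image of the specialized projector
    of the presentation; determinants can then be transferred by [det_add_mulmxC]. *)
Lemma pt_frame : exists (alpha : 'M[L]_(N, r.+1 * r.+1)) beta,
  [/\ beta *m alpha = 1%:M, alpha *m beta = map_mx K (lin1_mx (i \o p)),
      forall a, mxvec (G a) *m beta = map_mx K (i a) &
      forall a, map_mx K (i a) *m alpha = mxvec (G a)].
Proof.
have [beta betaP] := pt_coord GP i.
pose alpha := \matrix_(j < N) mxvec (G (p (delta_mx 0 j))).
have alphaP a : map_mx K (i a) *m alpha = mxvec (G a).
  rewrite mulmx_sum_row -{2}(ipK a) {2}[i a]row_sum_delta.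
  have -> (F : 'I_N -> C) : G (p (\sum_j F j *: delta_mx 0 j)) =
      \sum_j K (F j) *: G (p (delta_mx 0 j)).
    rewrite linear_sum; elim/big_rec2: _ => [|j u v _ <-]; first exact: pt0.
    by rewrite linearZ /= (pt_linear GP).
  rewrite linear_sum; apply: eq_bigr => j _.
  by rewrite rowK !mxE linearZ.
exists alpha, beta; split=> //; apply/row_matrixP => q; last first.
  by rewrite row_mul rowK betaP -map_row rowE mul_rV_lin1.
rewrite !rowE mulmx1; have [s Es] := pt_span GP (vec_mx (delta_mx 0 q)).
rewrite -[delta_mx 0 q]vec_mxK Es linear_sum !mulmx_suml; apply: eq_bigr => x _.
by rewrite linearZ /= -!scalemxAl mulmxA betaP alphaP.
Qed.

Lemma pt_endo_det (T : {linear A -> A}) (TL : {linear 'M[L]_r.+1 -> 'M[L]_r.+1}) :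
  (forall a, G (T a) = TL (G a)) -> K (endo_det T) = \det (lin_mx TL).
Proof.
move=> GT; have [alpha [beta [ba ab betaP alphaP]]] := pt_frame.
have E : map_mx K (lin1_mx (i \o T \o p)) = alpha *m lin_mx TL *m beta.
  apply/row_matrixP => j; rewrite !row_mul -map_row !rowE mul_rV_lin1 /=.
  have -> : delta_mx 0 j *m alpha = mxvec (G (p (delta_mx 0 j))).
    rewrite -[alpha]mulmx1 -ba (mulmxA alpha) ab mulmxA -(map_delta_mx K) -map_mxM.
    by rewrite mul_rV_lin1 alphaP.
  by rewrite mul_vec_lin -GT betaP.
rewrite /endo_det -det_map_mx map_mxD map_mxB map_mx1 E -ab.
rewrite -mulmxBl -{2}[alpha]mulmx1 -mulmxBr -mulmxA.
have := det_add_mulmxC 1 alpha ((lin_mx TL - 1%:M) *m beta).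
rewrite !expr1n mulr1 mul1r => ->; congr (\det _).
by rewrite -mulmxA ba mulmx1 addrC subrK.
Qed.

Lemma pt_rank_poly : map_poly K rank_poly = 'X^(r.+1 * r.+1).
Proof.
have [alpha [beta [ba ab _ _]]] := pt_frame.
rewrite /rank_poly -det_map_mx map_mxD map_mx1 map_mxZ rmorphB /= map_polyX.
rewrite (rmorph1 (map_poly K)).
have -> : map_mx (map_poly K) (map_mx polyC (lin1_mx (i \o p))) =
    map_mx polyC alpha *m map_mx polyC beta.
  by rewrite -map_mxM ab; apply/matrixP => j k; rewrite !mxE map_polyC.
have := det_add_mulmxC 1 (map_mx polyC alpha) (('X - 1) *: map_mx polyC beta).
rewrite !expr1n mulr1 mul1r -scalemxAr -scalemxAl -(map_mxM _ beta) ba map_mx1 => E.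
rewrite [LHS]E.
by rewrite scalemx1 -raddfD /= addrC subrK det_scalar.
Qed.

Lemma pt_rank_coef r' : phi (rank_coef r')%:A = (r' == r)%:R.
Proof.
rewrite /rank_coef -[LHS]/(K _) -coef_map pt_rank_poly coefXn; congr (nat_of_bool _)%:R.
apply/eqP/eqP => [|-> //] E; apply/eqP; rewrite -eqSS.
by rewrite -(eqn_sqr r'.+1) !expnS !expn0 !muln1 E.
Qed.
End AtPoint.
End Presentation.

(** * Descent of the reduced norm *)

(* mu reads off the coefficients of 1 and y^(r+1) in a relation of degree r.+1
   satisfied by y. *)
Definition end_functional (C : comNzRingType) (A : algType C) (r : nat) (y : A)
    (mu : A -> C) : Prop :=
  linear_functional mu /\ forall k, (0 < k <= r)%N -> mu (y ^+ k) = 0.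

Section ReducedNorm.
Variables (C : comNzRingType) (A : algType C) (S : comAlgType C) (n : nat).
Variable (f : A -> 'M[S]_n).
Hypothesis fP : splitting f.
Hypothesis Afaithful : forall c : C, (forall a : A, c *: a = 0) -> c = 0.
Local Notation Nrd := (split_det f).

Section Presented.
Variables (N : nat) (i : {linear A -> 'rV[C]_N}) (p : {linear 'rV[C]_N -> A}).
Hypothesis ipK : cancel i p.

Lemma presented_fg_projective : fg_projective A.
Proof. by exists N, i, p. Qed.

(** At a point the relation holds after multiplication by an element of S that depends on the point.
    The local-global principle on the locus of degree r+1 replaces all these elements by one power
    of [rank_coef], which lies in C. *)
Lemma reduced_relation r y mu : end_functional r y mu ->
  exists k, (rank_coef i p r ^+ k)%:A *
    ((mu (y ^+ r.+1))%:A + (-1) ^+ r.+1 * Nrd y * (mu 1)%:A) = 0 :> S.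
Proof.
case=> muP mu0; set Z := _ + _.
have [L phi wphi|k] := @ideal_local_power S _ (rank_coef i p r)%:A (annihilator_ideal Z).
  have [r' [G GP]] := split_point_exists fP Afaithful presented_fg_projective phi.
  have r'r : r = r'.
    apply/eqP; move: wphi; rewrite (pt_rank_coef ipK GP).
    by case: (r == r') => //; rewrite eqxx.
  rewrite -r'r in G GP; have [x x0 xZ] := pt_relation GP muP mu0.
  by exists x.
by rewrite /= -[_%:A ^+ k](rmorphXn (GRing.in_alg S)) => ?; exists k.
Qed.

(** Eliminating [Nrd y] between the relations for y and z leaves [Nrd b] as the only quantity
    outside C. *)
Lemma reduced_relation2 r y z b mu nu : end_functional r y mu ->
  end_functional r z nu -> Nrd z = Nrd b * Nrd y ->
  exists k, (rank_coef i p r ^+ k)%:A * ((mu 1 * nu (z ^+ r.+1))%:A -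
    Nrd b * (nu 1 * mu (y ^+ r.+1))%:A) = 0 :> S.
Proof.
move=> /reduced_relation[k Ek] /reduced_relation[l El] Ez; exists (k + l)%N.
rewrite exprD; move: Ek El; rewrite Ez.
move: (rank_coef i p r ^+ k) (rank_coef i p r ^+ l) => w w'.
have [K KE] : exists K : {rmorphism C -> S}, forall c, c%:A = K c.
  by exists (GRing.in_alg S).
rewrite !KE !rmorphM; move: (K w) (K w') (K (mu 1)) (K (nu 1)) => W W' d1 d2.
move: (K (mu _)) (K (nu _)) ((-1) ^+ _) => m1 m2 e Ek El.
transitivity (W * d1 * (W' * (m2 + e * (Nrd b * Nrd y) * d2)) -
  W' * Nrd b * d2 * (W * (m1 + e * Nrd y * d1))); first by ring.
by rewrite Ek El !mulr0 subrr.
Qed.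

(** Cramer's rule. The powers 1, z, ..., z^r are independent at phi, so some maximal minor [M] of
    their coordinates is nonzero there; [mu] is \det M times the coefficient at 1, taken in the
    selected coordinates. *)
Lemma end_functional_exists (L : fieldType) (phi : {rmorphism S -> L}) r
    (G : A -> 'M[L]_r.+1) z : split_point f phi G ->
  \det (regular_mx (G z)) != 0 ->
  exists2 mu, end_functional r z mu & phi (mu 1)%:A != 0.
Proof.
move=> GP dz; have [alpha [beta [_ _ _ alphaP]]] := pt_frame ipK GP.
pose K := phi \o GRing.in_alg S.
pose M0 := \matrix_(k < r.+1) i (z ^+ k).
pose gam : 'M[L]_(r.+1 * r.+1, r.+1) := \matrix_(q, j) (q == mxvec_index 0 j)%:R.
have Mreg : map_mx K M0 *m (alpha *m gam) = regular_mx (G z).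
  apply/row_matrixP => k; rewrite row_mul -map_row rowK mulmxA alphaP.
  apply/rowP => j; rewrite !mxE (bigD1 (mxvec_index 0 j)) //= mxvecE mxE eqxx mulr1.
  rewrite (ptX GP) big1 ?addr0 // => q /negPf qj.
  by rewrite [gam _ _]mxE qj mulr0.
have M0full : row_full (map_mx K M0)^T.
  rewrite /row_full mxrank_tr; apply/row_freeP.
  exists ((alpha *m gam) *m invmx (regular_mx (G z))).
  by rewrite mulmxA Mreg mulmxV // unitmxE unitfE.
pose sel m (X : 'M[C]_(m, N)) := (rowsub (fullrankfun M0full) X^T)^T.
pose M := sel _ M0.
exists (fun a => (sel _ (i a) *m \adj M) 0 0); last first.
  have -> : (sel _ (i 1) *m \adj M) 0 0 = \det M.
    have := congr1 (fun X : 'M_r.+1 => X 0 0) (mul_mx_adj M).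
    rewrite /= [RHS]mxE eqxx mulr1n => <-; rewrite !mxE; apply: eq_bigr => j _.
    by rewrite !mxE expr0.
  suff : \det (map_mx K M) != 0 by rewrite det_map_mx.
  rewrite -unitfE -unitmxE -unitmx_tr.
  have -> : (map_mx K M)^T = rowsub (fullrankfun M0full) (map_mx K M0)^T.
    by apply/matrixP => j k; rewrite !mxE.
  exact: fullrowsub_unit.
split=> [c a b|k /andP[k0 kr]].
  have -> : sel _ (i (c *: a + b)) = c *: sel _ (i a) + sel _ (i b).
    by apply/matrixP => j k; rewrite linearP !mxE.
  by rewrite mulmxDl -scalemxAl !mxE.
have kr' : (k < r.+1)%N by rewrite ltnS.
have := congr1 (fun X : 'M_r.+1 => X (Ordinal kr') 0) (mul_mx_adj M).
rewrite /= [RHS]mxE -val_eqE /= (gtn_eqF k0) mulr0n => <-.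
rewrite !mxE; apply: eq_bigr => j _.
by rewrite !mxE.
Qed.

Hypothesis Cinf : forall (L : fieldType) (phi : {rmorphism S -> L}) (k : nat),
  exists2 s : seq C, size s = k & uniq (map (phi \o GRing.in_alg S) s).

Lemma local_functionals (L : fieldType) (phi : {rmorphism S -> L}) b b' :
  b * b' = 1 -> exists r (y : A) (mu nu : A -> C),
  [/\ end_functional r y mu, end_functional r (b * y) nu,
      phi (mu (y ^+ r.+1))%:A != 0, phi (nu 1)%:A != 0 &
      phi (rank_coef i p r)%:A != 0].
Proof.
move=> bb'; have [r [G GP]] := split_point_exists fP Afaithful presented_fg_projective phi.
have uB : G b \in unitmx.
  have : G b *m G b' = 1%:M by rewrite -(pt_mul GP) bb' (pt_one GP).
  by case/mulmx1_unit.
have [gP gn0] := regular_exists (Cinf phi) uB.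
have [y] := generic_point (Cinf phi) (pt_linear GP) (pt_span GP) gP gn0.
rewrite -(pt_mul GP) !mulf_eq0 !negb_or => /and3P[y0 ry rby].
have [mu muP mu1] := end_functional_exists GP ry.
have [nu nuP nu1] := end_functional_exists GP rby.
exists r, y, mu, nu; split=> //; last by rewrite (pt_rank_coef ipK GP) eqxx oner_neq0.
(* By the relation at phi, the value of [mu] at y^(r+1) is up to sign the product of [mu 1] and \det
   (G y), both nonzero. *)
have [x x0 /(congr1 phi)/eqP] := pt_relation GP muP.1 muP.2.
rewrite rmorphM rmorph0 mulf_eq0 (negPf x0) /= rmorphD !rmorphM rmorphXn rmorphN1.
rewrite (pt_det GP) addr_eq0 => /eqP ->.
by rewrite oppr_eq0 !mulf_neq0 // signr_eq0.
Qed.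
End Presented.
End ReducedNorm.

Section Descent.
Variables (C : comNzRingType) (A : algType C) (S : comAlgType C) (n : nat).
Variable (f : A -> 'M[S]_n).
Hypothesis fP : splitting f.
Hypothesis ffS : faithfully_flat S.
Hypothesis Afaithful : forall c : C, (forall a : A, c *: a = 0) -> c = 0.
Hypothesis Aproj : fg_projective A.
Hypothesis Cinf : forall (L : fieldType) (phi : {rmorphism S -> L}) (k : nat),
  exists2 s : seq C, size s = k & uniq (map (phi \o GRing.in_alg S) s).
Local Notation Nrd := (split_det f).

Lemma Nrd_descends b b' : b * b' = 1 -> exists c : C, Nrd b = c%:A.
Proof.
move=> bb'; have [N [i [p ipK]]] := Aproj.
(* The ideal of denominators of [Nrd b]. *)
pose I := [set w : C | exists c : C, w%:A * Nrd b = c%:A].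
suff [c] : I 1 by rewrite scale1r mul1r => E; exists c.
apply: (ff_local ffS) => [|L phi].
  split; first by exists 0; rewrite !scale0r mul0r.
  move=> a u v [c Ec] [d Ed]; exists (a * c + d).
  by rewrite scalerDl -scalerA mulrDl Ed -scalerAl Ec scalerA -scalerDl.
have [r [y [mu [nu [muP nuP m0 d0 w0]]]]] :=
  local_functionals fP Afaithful ipK Cinf phi bb'.
have [k] := reduced_relation2 fP Afaithful ipK muP nuP (split_detM fP b y).
have [K KE] : exists K : {rmorphism C -> S}, forall c, c%:A = K c.
  by exists (GRing.in_alg S).
rewrite !KE in m0 d0 w0 * => E.
exists (rank_coef i p r ^+ k * (nu 1 * mu (y ^+ r.+1))); last first.
  by rewrite KE !rmorphM rmorphXn !mulf_neq0 // rmorphXn expf_neq0.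
exists (rank_coef i p r ^+ k * (mu 1 * nu ((b * y) ^+ r.+1))).
move/eqP: E; rewrite !KE mulrBr subr_eq0 => /eqP E.
by rewrite rmorphM [RHS]rmorphM E; ring.
Qed.

Variables (sC : {rmorphism C -> C}) (sigma : A -> A).
Hypothesis sCK : involutive sC.
Hypothesis sigmaD : forall a b, sigma (a + b) = sigma a + sigma b.
Hypothesis sigmaM : forall a b, sigma (a * b) = sigma b * sigma a.
Hypothesis sigmaK : involutive sigma.
Hypothesis sigmaZ : forall c a, sigma (c *: a) = sC c *: sigma a.

Lemma sigma1 : sigma 1 = 1.
Proof. by rewrite -[LHS]mul1r -{1}[1]sigmaK -sigmaM mul1r sigmaK. Qed.

Lemma sigmaX a k : sigma (a ^+ k) = sigma a ^+ k.
Proof. by elim: k => [|k IHk]; [exact: sigma1 | rewrite exprS sigmaM IHk exprSr]. Qed.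

Lemma sigma_end_functional r y mu : end_functional r y mu ->
  end_functional r (sigma y) (fun a => sC (mu (sigma a))).
Proof.
case=> muP mu0; split=> [c a b|k k_r].
  by rewrite sigmaD sigmaZ muP rmorphD rmorphM sCK.
by rewrite sigmaX sigmaK mu0 // rmorph0.
Qed.

Section ConjugatePresentation.
Variables (N : nat) (i : {linear A -> 'rV[C]_N}) (p : {linear 'rV[C]_N -> A}).

(** The presentation transported by sigma. Its rank coefficient is the conjugate of the original
    one, so a relation for [sigma y] returns, after applying [sC], with a power of the coefficient
    already known to be nonzero at the point. *)
Definition conj_incl (a : A) : 'rV[C]_N := map_mx sC (i (sigma a)).
Fact conj_incl_linear : linear conj_incl.
Proof.
by move=> c a b; rewrite /conj_incl sigmaD sigmaZ linearP map_mxD map_mxZ /= sCK.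
Qed.
HB.instance Definition _ :=
  GRing.isLinear.Build C A 'rV[C]_N *:%R conj_incl conj_incl_linear.

Definition conj_proj (v : 'rV[C]_N) : A := sigma (p (map_mx sC v)).
Fact conj_proj_linear : linear conj_proj.
Proof.
move=> c a b.
by rewrite /conj_proj map_mxD map_mxZ linearD linearZ sigmaD sigmaZ /= sCK.
Qed.
HB.instance Definition _ :=
  GRing.isLinear.Build C 'rV[C]_N A *:%R conj_proj conj_proj_linear.

Lemma map_mx_invol m k (M : 'M[C]_(m, k)) : map_mx sC (map_mx sC M) = M.
Proof. by apply/matrixP => ? ?; rewrite !mxE sCK. Qed.

Hypothesis ipK : cancel i p.

Lemma conj_inclK : cancel conj_incl conj_proj.
Proof. by move=> a; rewrite /conj_incl /conj_proj map_mx_invol ipK sigmaK. Qed.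

Lemma conj_lin1 (T T' : {linear A -> A}) : (forall a, sigma (T (sigma a)) = T' a) ->
  lin1_mx (conj_incl \o T' \o conj_proj) = map_mx sC (lin1_mx (i \o T \o p)).
Proof.
move=> TT'; apply/row_matrixP => j.
rewrite -map_row !rowE !mul_rV_lin1 /= /conj_incl /conj_proj map_delta_mx.
by rewrite -TT' !sigmaK.
Qed.

Lemma conj_lin1_id : lin1_mx (conj_incl \o conj_proj) = map_mx sC (lin1_mx (i \o p)).
Proof. exact: (@conj_lin1 idfun idfun). Qed.

Lemma conj_rank_coef r :
  rank_coef conj_incl conj_proj r = sC (rank_coef i p r).
Proof.
rewrite /rank_coef -coef_map; congr (_`_ _).
rewrite /rank_poly -det_map_mx map_mxD map_mx1 map_mxZ rmorphB /= map_polyX.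
rewrite conj_lin1_id; set M := lin1_mx _.
have -> : map_mx (map_poly sC) (map_mx polyC M) = map_mx polyC (map_mx sC M).
  by apply/matrixP => j k; rewrite !mxE /= map_polyC.
by rewrite (rmorph1 (map_poly sC)).
Qed.

Lemma conj_endo_det (T T' : {linear A -> A}) : (forall a, sigma (T (sigma a)) = T' a) ->
  endo_det conj_incl conj_proj T' = sC (endo_det i p T).
Proof.
move=> TT'; rewrite /endo_det -det_map_mx map_mxD map_mxB map_mx1.
by rewrite (conj_lin1 TT') conj_lin1_id.
Qed.

End ConjugatePresentation.

(* The relations characterizing the reduced norm have coefficients in C and are
   carried to relations for sigma b by the involution. *)
Lemma Nrd_involution b b' c : b' * b = 1 -> Nrd b = c%:A ->
  Nrd (sigma b) = (sC c)%:A.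
Proof.
move=> b'b Nb; have [N [i [p ipK]]] := Aproj.
have sbb' : sigma b * sigma b' = 1 by rewrite -sigmaM b'b sigma1.
apply/eqP; rewrite -subr_eq0; apply/eqP; set d := _ - _.
suff : [set x : S | x * d = 0] 1 by rewrite /= mul1r.
apply: ideal_local => [|L phi]; first exact: annihilator_ideal.
have [r [y [mu [nu [muP nuP m0 d0 w0]]]]] :=
  local_functionals fP Afaithful ipK Cinf phi sbb'.
have [k] := reduced_relation2 fP Afaithful ipK muP nuP (split_detM fP _ y).
have Nsz : Nrd (sigma (sigma b * y)) = Nrd b * Nrd (sigma y).
  by rewrite sigmaM sigmaK split_detM // mulrC.
have [l] := reduced_relation2 fP Afaithful (conj_inclK ipK)
  (sigma_end_functional muP) (sigma_end_functional nuP) Nsz.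
rewrite conj_rank_coef !sigma1 -!sigmaX !sigmaK Nb.
move: (rank_coef i p r) w0 (mu 1) (nu 1) d0 (mu _) m0 (nu _) => w w0 d1 d2 d20 m1 m10 m2.
have [K KE] : exists K : {rmorphism C -> S}, forall c, c%:A = K c.
  by exists (GRing.in_alg S).
rewrite /d {d} !KE -!rmorphM -rmorphB -rmorphM -[K (sC w ^+ _ * _)]KE.
(* Every term of this relation comes from C, so it descends to C, the only place where [sC] can be
   applied. *)
move=> /(ff_inj ffS)/(congr1 sC).
rewrite rmorph0 !rmorphM rmorphB !rmorphM !rmorphXn /= !sCK => El Ek.
exists (K (w ^+ (k + l) * (d2 * m1))) => /=; last first.
  by rewrite !rmorphM rmorphXn !mulf_neq0 // ?rmorphXn ?expf_neq0 // -KE.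
move: Ek (congr1 K El) => {El}; rewrite rmorph0 !rmorphM !rmorphXn rmorphB !rmorphM.
move: (Nrd _) (K w) (K d1) (K d2) (K m1) (K m2) (K (sC c)) => X W D1 D2 M1 M2 c'.
move: (W ^+ k) (W ^+ l) (W ^+ (k + l)) (exprD W k l) => Wk Wl _ -> Ek El.
transitivity (Wk * (Wl * (D1 * M2 - c' * (D2 * M1))) - Wl * (Wk * (D1 * M2 - X * (D2 * M1)))).
  by ring.
by rewrite Ek El !mulr0 subrr.
Qed.
End Descent.

(** * Semilocal rings *)

Section Semilocal.
Variable R : comNzRingType.

Lemma maximal_comaximal (m m' : set R) : maximal_ideal m -> maximal_ideal m' ->
  m <> m' -> exists2 x, m' x & m (x - 1).
Proof.
move=> [idm m1 maxm] [idm' m'1 maxm'] mm'.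
have [y m'y my] : exists2 y, m' y & ~ m y.
  apply: contrapT => h; apply: mm'; apply: maxm' => // y m'y.
  by apply: contrapT => my; apply: h; exists y.
have [a [b [mb E]]] : [set z | exists a b, m b /\ z = a * y + b] 1.
  apply: contrapT => n1; apply: my.
  rewrite -(maxm _ (ideal_add y idm)) //; last first.
    by move=> b mb; exists 0, b; rewrite mul0r add0r.
  by exists 1, 0; rewrite mul1r addr0; split=> //; exact: idm.1.
exists (a * y); first exact: idealM.
by rewrite E opprD addrA subrr sub0r -mulN1r; exact: idealM.
Qed.

Hypothesis Rsemilocal : semilocal R.

Lemma chinese_idempotents : exists (ms : seq (set R)) (eps : set R -> R),
  [/\ uniq ms, forall m, maximal_ideal m <-> m \in ms,
      forall m, maximal_ideal m -> m (eps m - 1) &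
      forall m m', maximal_ideal m -> maximal_ideal m' -> m <> m' -> m' (eps m)].
Proof.
have /finite_seqP[ms0 Ems] := Rsemilocal.
have msP m : maximal_ideal m <-> m \in undup ms0.
  by rewrite mem_undup; have /= -> := congr1 (fun X : set (set R) => X m) Ems.
pose Q (mm : set R * set R) x := maximal_ideal mm.1 -> maximal_ideal mm.2 ->
  mm.1 <> mm.2 -> mm.2 x /\ mm.1 (x - 1).
have /choice[x xP] (mm : set R * set R) : exists x, Q mm x.
  have [h|h] := pselect (exists x, Q mm x) => //.
  exists 0 => h1 h2 h3; case: h; have [x x1 x2] := maximal_comaximal h1 h2 h3.
  by exists x.
exists (undup ms0), (fun m => \prod_(m' <- undup ms0 | m' != m) x (m, m')).
split=> [|//|m mm|m m' mm mm' mm'n]; first exact: undup_uniq.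
- have [L [phi phiP]] := prime_ideal_field (maximal_prime mm).
  apply/phiP; rewrite rmorphB rmorph1 rmorph_prod big_seq_cond.
  rewrite big1 ?subrr // => m' /andP[/msP mm' m'm].
  have [|_ /phiP] := xP (m, m') mm mm'; first by move=> /= E; rewrite E eqxx in m'm.
  by rewrite rmorphB rmorph1 => /eqP; rewrite subr_eq0 => /eqP.
- rewrite big_mkcond (bigD1_seq m') ?undup_uniq //=; last exact/msP.
  have -> : m' != m by apply/eqP => E; apply: mm'n.
  rewrite mulrC; apply: idealM; first by case: mm'.
  by have [] := xP (m, m') mm mm'.
Qed.

Lemma chinese_sum (ms : seq (set R)) (eps : set R -> R) :
  [/\ uniq ms, forall m, maximal_ideal m <-> m \in ms,
      forall m, maximal_ideal m -> m (eps m - 1) &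
      forall m m', maximal_ideal m -> maximal_ideal m' -> m <> m' -> m' (eps m)] ->
  forall (m : set R) (L : fieldType) (chi : {rmorphism R -> L}) (a : set R -> L),
  maximal_ideal m -> (forall r, chi r = 0 <-> m r) ->
  \sum_(m' <- ms) chi (eps m') * a m' = a m.
Proof.
case=> ums msP eps1 eps0 m L chi a mm chiP.
rewrite (bigD1_seq m) //=; last exact/msP.
have /chiP := eps1 m mm; rewrite rmorphB rmorph1 => /eqP; rewrite subr_eq0 => /eqP ->.
rewrite mul1r big_seq_cond big1 ?addr0 // => m' /andP[/msP mm' m'm].
rewrite (chiP _).2 ?mul0r //; apply: eps0 => // E.
by rewrite E eqxx in m'm.
Qed.

Hypothesis Rinfinite : infinite_residue_fields R.

(** The kernel of [chi] is only asked to lie in m, so the same sequence stays distinct at points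
    over smaller primes. *)
Lemma incongruent_seq m k : maximal_ideal m -> exists2 s : seq R, size s = k &
  forall (L : fieldType) (chi : {rmorphism R -> L}), (forall r, chi r = 0 -> m r) ->
  uniq (map chi s).
Proof.
move=> mm; have /infiniteP/pcard_leP[h] := Rinfinite mm.
have /choice[g gP] (j : nat) : exists x : R, [set y | m (y - x)] = h j.
  have [x _ <-] : cosets m (h j) by exact: funS.
  by exists x.
exists (map g (iota 0 k)) => [|L chi chiP]; first by rewrite size_map size_iota.
rewrite -map_comp map_inj_uniq ?iota_uniq // => a b /= Eab.
have idm : ideal m by case: mm.
have mab : m (g a - g b) by apply: chiP; rewrite rmorphB Eab subrr.
suff E : h a = h b by apply: (@inj _ _ _ h) => //; rewrite in_setT.
rewrite -!gP; apply/seteqP; split=> y /= my.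
  by rewrite -[y](subrK (g a)) -addrA; exact: idealD.
rewrite -[y](subrK (g b)) -addrA; apply: idealD => //.
by rewrite -opprB -mulN1r; exact: idealM.
Qed.
End Semilocal.

(** * Skew elements of an etale quadratic extension *)

Section UniqueLift.
Variables (R : comNzRingType) (C : comAlgType R) (I J : set C).
Variables (idI : ideal I) (I1 : ~ I 1) (idJ : ideal J) (J1 : ~ J 1).
Hypotheses (IJ : I `<=` J) (JJ : forall x y, J x -> J y -> I (x * y)).
Variable (s : {rmorphism C -> C}).
Hypothesis sZ : forall (r : R) c, s (r *: c) = r *: s c.
Hypothesis sJ : forall c, J (c - s c).

Local Notation piI := (quotient_map idI I1).
Local Notation piJ := (quotient_map idJ J1).
Local Notation B := (via (piI \o GRing.in_alg C)).
Local Notation B' := (via (piJ \o GRing.in_alg C)).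

Definition to_quotient (K : set C) (idK : ideal K) (K1 : ~ K 1) (h : C -> C) (c : C) :
  via (quotient_map idK K1 \o GRing.in_alg C) := quotient_map idK K1 (h c).

Section ToQuotient.
Variables (K : set C) (idK : ideal K) (K1 : ~ K 1) (h : {rmorphism C -> C}).
Hypothesis hZ : forall (r : R) c, h (r *: c) = r *: h c.
Definition to_quotient_alg of (forall (r : R) c, h (r *: c) = r *: h c) :=
  to_quotient idK K1 h.
Fact to_quotient_linear : linear (to_quotient_alg hZ).
Proof.
move=> a u v; rewrite via_scaleE /to_quotient_alg /to_quotient rmorphD hZ.
by rewrite -mulr_algl !rmorphD !rmorphM.
Qed.
HB.instance Definition _ := GRing.isLinear.Build R C _ *:%R (to_quotient_alg hZ)
  to_quotient_linear.
Fact to_quotient_monoid : monoid_morphism (to_quotient_alg hZ).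
Proof.
rewrite /to_quotient_alg /to_quotient.
by split=> [|u v]; rewrite ?rmorph1 ?rmorphM.
Qed.
HB.instance Definition _ := GRing.isMonoidMorphism.Build C _ (to_quotient_alg hZ)
  to_quotient_monoid.
End ToQuotient.

Definition quotient_step (b : B) : B' :=
  piJ (projT1 (cid (quotient_map_surj (b : quotient idI I1)))).

Lemma quotient_stepE c : quotient_step (piI c) = piJ c.
Proof.
rewrite /quotient_step; case: cid => x /= xc; apply/eqP; rewrite -subr_eq0.
apply/eqP; rewrite -rmorphB; apply/quotient_map_eq0/IJ/(quotient_map_eq0 idI I1).
by rewrite rmorphB /= xc subrr.
Qed.

Fact quotient_step_linear : linear quotient_step.
Proof.
move=> a u v; have [x <-] := quotient_map_surj u; have [y <-] := quotient_map_surj v.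
rewrite !via_scaleE !quotient_stepE /= -[X in quotient_step (X + _)](rmorphM piI).
by rewrite -[X in quotient_step X](rmorphD piI) quotient_stepE rmorphD rmorphM.
Qed.
HB.instance Definition _ := GRing.isLinear.Build R B B' *:%R quotient_step
  quotient_step_linear.
Fact quotient_step_monoid : monoid_morphism quotient_step.
Proof.
split; first by rewrite -[1](rmorph1 piI) quotient_stepE rmorph1.
move=> u v; have [x <-] := quotient_map_surj u; have [y <-] := quotient_map_surj v.
by rewrite -[X in quotient_step X](rmorphM piI) !quotient_stepE rmorphM.
Qed.
HB.instance Definition _ := GRing.isMonoidMorphism.Build B B' quotient_step
  quotient_step_monoid.

(** The projection from C to C/I and its composite with [s] both lift the projection to C/J, and J/I
    has square zero. *)
Lemma unique_lift : formally_etale C -> forall c, I (c - s c).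
Proof.
move=> fe c.
pose g : {lrmorphism C -> B'} := @to_quotient_alg J idJ J1 idfun (fun r c => erefl).
pose h : {lrmorphism C -> B} := @to_quotient_alg I idI I1 idfun (fun r c => erefl).
pose h' : {lrmorphism C -> B} := @to_quotient_alg I idI I1 s sZ.
pose q : {lrmorphism B -> B'} := quotient_step.
have [| |_ uniq] := fe B B' q _ _ g.
- by move=> y; have [x <-] := quotient_map_surj y; exists (piI x); exact: quotient_stepE.
- move=> u v; have [x <-] := quotient_map_surj u; have [y <-] := quotient_map_surj v.
  rewrite /q /= !quotient_stepE => /quotient_map_eq0 Jx /quotient_map_eq0 Jy.
  by rewrite -[LHS](rmorphM piI); apply/quotient_map_eq0/JJ.
apply/(quotient_map_eq0 idI I1); rewrite rmorphB; apply/eqP; rewrite subr_eq0.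
apply/eqP; apply: (uniq h h') => d; first exact: quotient_stepE.
rewrite /q /h' /= /to_quotient_alg /to_quotient quotient_stepE.
apply/eqP; rewrite eq_sym -subr_eq0 -rmorphB; apply/eqP.
exact/(quotient_map_eq0 idJ J1).
Qed.
End UniqueLift.

Section Etale.
Variables (R : comNzRingType) (C : comAlgType R) (sC : {rmorphism C -> C}).
Hypothesis Cetale : etale_quadratic C.
Hypothesis sCK : involutive sC.
Hypothesis sC_fixed : forall c : C, sC c = c <-> exists r : R, c = r%:A.
Variable half : R.
Hypothesis half2 : 2%:R * half = 1.
Variable m : set R.
Hypothesis mm : maximal_ideal m.

Let idm : ideal m. Proof. by case: mm. Qed.
Let m1 : ~ m 1. Proof. by case: mm. Qed.
Let primem : forall x y, m (x * y) -> m x \/ m y.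
Proof. by case: (maximal_prime mm). Qed.

Lemma sC_scalar (r : R) : sC r%:A = r%:A.
Proof. by apply/sC_fixed; exists r. Qed.

Lemma sC_scale (r : R) c : sC (r *: c) = r *: sC c.
Proof. by rewrite -mulr_algl rmorphM sC_scalar mulr_algl. Qed.

Lemma trace_exists : exists tr : C -> R, forall c, c + sC c = (tr c)%:A.
Proof.
suff /choice[tr trP] c : exists t : R, c + sC c = t%:A by exists tr.
by apply/sC_fixed; rewrite rmorphD sCK addrC.
Qed.

(** Local rank 2 is contradicted: if [kap *: b 0] and [kap *: b 1] are both scalars, each multiplied
    by the scalar of the other gives a linear relation, which forces the basis element [b 0] to be
    torsion outside m. *)
Lemma not_nearly_scalar kap : ~ m kap -> ~ (forall c : C, exists r : R, kap *: c = r%:A).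
Proof.
move=> mkap /choice[rho rhoP]; have [_ rk _] := Cetale.
have [b [_ free]] := rk m (maximal_prime mm).
have nM x y : ~ m x -> ~ m y -> ~ m (x * y) by move=> mx my /primem[].
have kill s : ~ m s -> s *: b 0 <> 0.
  move=> ms sb; have [|t [mt]] := free (fun j => (j == 0)%:R) _ 0.
    exists s; split=> //; rewrite big_ord_recl big_ord1 /= scale1r scale0r addr0 //.
  by rewrite eqxx mulr1 => t0; apply: mt; rewrite t0; exact: idm.1.
have [|t [mt Et]] :=
    free (fun j => if j == 0 then rho (b 1) * kap else - (rho (b 0) * kap)) _ 1.
  exists 1; split=> //; rewrite scale1r big_ord_recl big_ord1 /=.
  rewrite scaleNr -!scalerA.
  have -> : lift ord0 ord0 = 1 :> 'I_2 by apply/val_inj.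
  by rewrite !rhoP !scalerA mulrC subrr.
apply: (kill (t * kap * kap)); first exact: nM (nM _ _ mt mkap) mkap.
move: Et; rewrite /= mulrN => /eqP; rewrite oppr_eq0 => /eqP Et.
by rewrite -!scalerA [kap *: b 0]rhoP [kap *: _]scalerA scalerA (mulrC kap) Et scale0r.
Qed.

Lemma two_notin_maximal : ~ m 2%:R.
Proof.
move=> m2; apply: m1; rewrite -half2 mulrC; exact: idealM.
Qed.

(** Taking traces in 1 = sum m_k c_k gives an element [mu] of m such that 2 - mu kills C. As 2 is
    not in m, this contradicts [not_nearly_scalar]. *)
Lemma extended_maximal_proper : ~ extended_ideal m (1 : C).
Proof.
case=> t tm E; have [tr trP] := trace_exists.
pose mu := \sum_(x <- t) x.1 * tr x.2.
have mmu : m mu.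
  rewrite /mu big_seq; elim/big_ind: _ => [|x y|x /tm mx]; first exact: idm.1.
    exact: idealD.
  by rewrite mulrC; exact: idealM.
have E2 : (2%:R - mu)%:A = 0 :> C.
  rewrite scalerBl scaler_nat mulr2n -{2}[1](rmorph1 sC) {1 2}E rmorph_sum -big_split.
  rewrite /mu scaler_suml; apply/eqP; rewrite subr_eq0; apply/eqP.
  by apply: eq_bigr => x _; rewrite /= sC_scale -scalerDr trP scalerA.
apply: (@not_nearly_scalar (2%:R - mu)) => [m2|c].
  by apply: two_notin_maximal; rewrite -[2%:R](subrK mu); exact: idealD.
by exists 0; rewrite scale0r -[c]mul1r scalerAl E2 mul0r.
Qed.

Lemma residue_point (S : comAlgType C) : faithfully_flat S ->
  exists (L : fieldType) (phi : {rmorphism S -> L}),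
    forall r : R, phi (r%:A : C)%:A = 0 <-> m r.
Proof.
move=> ffS.
have [L [phi phiP]] := ff_point ffS (extended_ideal_ideal C m) extended_maximal_proper.
exists L, phi => r; split; last by move=> mr; apply/phiP/sub_extended_ideal.
have [K KE] : exists K : {rmorphism R -> L}, forall r, phi (r%:A : C)%:A = K r.
  by exists (phi \o GRing.in_alg S \o GRing.in_alg C).
rewrite KE => r0; apply: contrapT => mr.
have idK : ideal [set x | K x = 0].
  split; first by rewrite /= rmorph0.
  by move=> a u v /= u0 v0; rewrite rmorphD rmorphM u0 v0 mulr0 addr0.
case: mm => _ _ maxm; apply: mr; rewrite -(maxm _ idK) //.
  by move=> x mx /=; rewrite -KE; apply/phiP/sub_extended_ideal.
by move/eqP; rewrite rmorph1 oner_eq0.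
Qed.

Section Skew.
Variables (L : fieldType) (g : {rmorphism C -> L}).
Hypothesis gP : forall r : R, g r%:A = 0 <-> m r.
Hypothesis noskew : forall e, sC e = - e -> g e = 0.
Variables (N : nat) (i : {linear C -> 'rV[R]_N}) (p : {linear 'rV[R]_N -> C}).
Hypothesis ipK : cancel i p.

Definition in_mC (x : C) := forall j, m (i x 0 j).

Lemma in_mCD x y : in_mC x -> in_mC y -> in_mC (x + y).
Proof. by move=> mx my j; rewrite linearD mxE; exact: idealD. Qed.

Lemma in_mCZ r x : m r -> in_mC (r *: x).
Proof. by move=> mr j; rewrite linearZ mxE mulrC; exact: idealM. Qed.

Lemma in_mCM c x : in_mC x -> in_mC (c * x).
Proof.
move=> mx j; rewrite -[x]ipK [i x]row_sum_delta linear_sum mulr_sumr linear_sum.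
rewrite summxE; apply: ideal_sum => // k.
by rewrite linearZ -scalerAr linearZ mxE mulrC; exact: idealM.
Qed.

Lemma sC_skew x : sC (x - sC x) = - (x - sC x).
Proof. by rewrite rmorphB sCK opprB. Qed.

Lemma g_sC x : g (sC x) = g x.
Proof.
have /eqP := noskew (sC_skew x); rewrite rmorphB subr_eq0 => /eqP -> //.
Qed.

Definition residual_kernel : set C := [set x | g x = 0].
(** Chosen to contain all products of two elements of [residual_kernel] and still record skew parts
    modulo m C, which is what unique lifting then controls. *)
Definition thick_kernel : set C := [set x | g x = 0 /\ in_mC (x - sC x)].

Lemma residual_kernel_ideal : ideal residual_kernel.
Proof.
split; first by rewrite /residual_kernel /= rmorph0.
by move=> a u v /= u0 v0; rewrite /residual_kernel /= rmorphD rmorphM u0 v0 mulr0 addr0.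
Qed.

Lemma halfC (c : C) : half%:A * (2%:R * c) = c.
Proof.
have -> : 2%:R = (2%:R : R)%:A :> C by rewrite scaler_nat.
by rewrite mulrA -scalerAl mul1r scalerA mulrC [half * _]mulrC half2 scale1r mulr1.
Qed.

Lemma trace_in_m x : g x = 0 -> exists2 t, m t & x + sC x = t%:A.
Proof.
move=> gx; have [tr trP] := trace_exists; exists (tr x) => //.
by apply/gP; rewrite -trP rmorphD g_sC gx addr0.
Qed.

Lemma thick_kernel_ideal : ideal thick_kernel.
Proof.
split.
  split; first exact: rmorph0.
  by move=> j; rewrite rmorph0 subr0 linear0 mxE; exact: idm.1.
move=> a u v [gu mu] [gv mv]; split; first by rewrite rmorphD rmorphM gu gv mulr0 addr0.
have [t mt Et] := trace_in_m gu.
(* Here sigma(u) is written as half of t - (u - sigma(u)), where the trace t of u lies in m. *)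
have -> : a * u + v - sC (a * u + v) = a * (u - sC u) +
    half%:A * (t *: (a - sC a)) + half%:A * (sC a - a) * (u - sC u) + (v - sC v).
  rewrite rmorphD rmorphM -[t *: _]mulr_algl -Et.
  rewrite -[in LHS](halfC (a * u + v - _)); rewrite -[X in _ = X + _ + _ + _]halfC.
  rewrite -[X in _ = _ + X]halfC; ring.
apply: in_mCD => //; apply: in_mCD; last exact: in_mCM.
by apply: in_mCD; apply: in_mCM => //; exact: in_mCZ.
Qed.

Lemma residual_kernel_square x y : residual_kernel x -> residual_kernel y ->
  thick_kernel (x * y).
Proof.
move=> gx gy; split; first by rewrite rmorphM gx mul0r.
have [t mt Et] := trace_in_m gx; have [t' mt' Et'] := trace_in_m gy.
have -> : x * y - sC (x * y) = half%:A * (t *: (y - sC y) + t' *: (x - sC x)).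
  rewrite rmorphM -[t *: _]mulr_algl -[t' *: _]mulr_algl -Et -Et'.
  by rewrite -[LHS]halfC; congr (_ * _); ring.
by apply: in_mCM; apply: in_mCD; exact: in_mCZ.
Qed.

Lemma residual_kernel1 : ~ residual_kernel 1.
Proof. by move/eqP; rewrite rmorph1 oner_eq0. Qed.

Lemma thick_kernel1 : ~ thick_kernel 1.
Proof. by case=> /residual_kernel1. Qed.

Lemma in_mC_skew c : in_mC (c - sC c).
Proof.
have [_ _ fe] := Cetale.
have skewJ d : residual_kernel (d - sC d) by apply: noskew; exact: sC_skew.
have IJ : thick_kernel `<=` residual_kernel by move=> x [].
(* The factor [half] compensates for the doubling of a skew element under d |-> d - sigma(d). *)
have [_ h] := unique_lift thick_kernel_ideal thick_kernel1 residual_kernel_ideal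
  residual_kernel1 IJ residual_kernel_square sC_scale skewJ fe (half *: c).
suff -> : c - sC c = half *: c - sC (half *: c) - sC (half *: c - sC (half *: c)) by [].
rewrite sC_skew opprK -mulr2n sC_scale -scalerBr scalerMnl -mulr_natl.
by rewrite half2 scale1r.
Qed.

(** The projector [d] onto the skew part has a matrix [Pi] that vanishes modulo m, so [kap], the
    determinant of 1 - Pi, is outside m. Since (1 - Pi) Pi = 0, [kap] kills the skew part, and [kap]
    C would consist of scalars. *)
Lemma no_skew_contradiction : False.
Proof.
pose d (c : C) : C := half *: (c - sC c).
have dlin : linear d.
  move=> r a b; rewrite /d rmorphD sC_scale opprD addrACA -scalerBr scalerDr.
  by rewrite !scalerA mulrC.
pose D : {linear C -> C} := HB.pack d (GRing.isLinear.Build R C C *:%R d dlin).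
have dd c : d (d c) = d c.
  rewrite /d sC_scale -scalerBr sC_skew opprK -mulr2n -scalerMnr.
  by rewrite scalerMnl -mulr_natl half2 scale1r.
have [K KE] : exists K : {rmorphism R -> L}, forall r, g r%:A = K r.
  by exists (g \o GRing.in_alg C).
pose Pi := lin1_mx (i \o D \o p).
have iPi c : i c *m Pi = i (d c) by rewrite mul_rV_lin1 /= ipK.
have PiPi : (1%:M - Pi) *m Pi = 0.
  apply/row_matrixP => j; rewrite row0 row_mul -row_mul mulmxBl mul1mx linearB /=.
  rewrite row_mul !rowE mul_rV_lin1 /= iPi /D /= dd subrr //.
have KPi : map_mx K Pi = 0.
  apply/matrixP => j k; rewrite !mxE -KE; apply/gP.
  by rewrite /= /d -[half *: _]mulr_algl; exact: (in_mCM _ (in_mC_skew _)).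
pose kap := \det (1%:M - Pi).
have mkap : ~ m kap.
  move/gP; rewrite KE -det_map_mx map_mxB map_mx1 KPi subr0 det1 => /eqP.
  by rewrite oner_eq0.
have kapd c : kap *: d c = 0.
  apply: (can_inj ipK); rewrite linear0 linearZ /= -dd -iPi.
  by rewrite scalemxAr det_mulmx_annihilator ?mulmx0.
have [tr trP] := trace_exists.
apply: (not_nearly_scalar mkap) => c; exists (kap * (half * tr c)).
rewrite -!scalerA -trP -[LHS]subr0 -(kapd c) -scalerBr; congr (_ *: _).
have Ec : half *: (c + c) = c.
  by rewrite -mulr2n -scalerMnr scalerMnl -mulr_natl half2 scale1r.
rewrite -{1}Ec /d -scalerBr; congr (_ *: _).
by rewrite opprB addrA addrAC addrK.
Qed.
End Skew.

Lemma skew_exists (L : fieldType) (g : {rmorphism C -> L}) :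
  (forall r : R, g r%:A = 0 <-> m r) -> exists2 e, sC e = - e & g e != 0.
Proof.
move=> gP; apply: contrapT => h; have [[N [i [p ipK]]] _ _] := Cetale.
apply: (no_skew_contradiction gP _ ipK) => e se; apply: contrapT => ge.
by apply: h; exists e => //; apply/eqP.
Qed.
End Etale.

(** * Unitary elements *)

Lemma det_lin_mx_neq0 (L : fieldType) k (T T' : {linear 'M[L]_k -> 'M[L]_k}) :
  (forall X, T' (T X) = X) -> \det (lin_mx T) != 0.
Proof.
move=> TK; rewrite -unitfE -unitmxE.
have : lin_mx T *m lin_mx T' = 1%:M.
  apply/row_matrixP => q; rewrite row_mul !rowE mulmx1.
  by rewrite -[delta_mx 0 q]vec_mxK !mul_vec_lin TK.
by case/mulmx1_unit.
Qed.

Lemma lin_mx_unique (S : comNzRingType) k (T : {linear 'M[S]_k -> 'M[S]_k}) M :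
  (forall X, mxvec X *m M = mxvec (T X)) -> lin_mx T = M.
Proof.
move=> TM; apply/row_matrixP => q; rewrite !rowE -[delta_mx 0 q]vec_mxK TM.
by rewrite mul_vec_lin.
Qed.

(** * The Sylvester equation over a field *)

Section SylvesterEquation.
Variables (L : fieldType) (k : nat) (P Q : 'M[L]_k) (d : L).
Hypotheses (d0 : d != 0) (two0 : 2%:R != 0 :> L) (uP : P \in unitmx).

Definition sylvester_mx (t : L) : 'M[L]_(k * k) :=
  (1 + d * t) *: lin_mx (mulmx P) - (1 - d * t) *: lin_mx (mulmxr Q).

Lemma sylvester_mxE t Z : mxvec Z *m sylvester_mx t =
  mxvec ((1 + d * t) *: (P *m Z) - (1 - d * t) *: (Z *m Q)).
Proof.
by rewrite mulmxBr -!scalemxAr !mul_vec_lin linearB !linearZ.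
Qed.

Definition sylvester_pmx : 'M[{poly L}]_(k * k) :=
  (1 + d *: 'X) *: map_mx polyC (lin_mx (mulmx P)) -
  (1 - d *: 'X) *: map_mx polyC (lin_mx (mulmxr Q)).

Lemma horner_sylvester_pmx t : map_mx (horner_eval t) sylvester_pmx = sylvester_mx t.
Proof. by apply/matrixP => i j; rewrite !mxE /horner_eval !hornerE. Qed.

(** Cramer's numerator, that is, the determinant times the solution. Being polynomial in t, it turns
    invertibility of the solution into a generic condition. *)
Definition sylvester_solution : 'M[{poly L}]_k :=
  vec_mx (mxvec (d%:P%:M) *m \adj sylvester_pmx).

Lemma horner_sylvester_solution t : map_mx (horner_eval t) sylvester_solution =
  vec_mx (mxvec d%:M *m \adj (sylvester_mx t)).
Proof.
rewrite map_vec_mx map_mxM map_mxvec map_mx_adj horner_sylvester_pmx map_scalar_mx.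
by rewrite /= /horner_eval hornerC.
Qed.

Lemma sylvester_solution_det t Z :
  (1 + d * t) *: (P *m Z) - (1 - d * t) *: (Z *m Q) = d%:M ->
  vec_mx (mxvec d%:M *m \adj (sylvester_mx t)) = \det (sylvester_mx t) *: Z.
Proof.
move=> E; rewrite -E -sylvester_mxE -mulmxA mul_mx_adj mul_mx_scalar linearZ /=.
by rewrite mxvecK.
Qed.

(* At t = 1/d the second term vanishes and the equation reads 2 P Z = d. *)
Lemma sylvester_generic : exists2 p : {poly L}, p != 0 & forall t, p.[t] != 0 ->
  [/\ 1 + d * t != 0, 1 - d * t != 0, \det (sylvester_mx t) != 0 &
   forall Z, (1 + d * t) *: (P *m Z) - (1 - d * t) *: (Z *m Q) = d%:M -> \det Z != 0].
Proof.
have E0 : sylvester_mx d^-1 = 2%:R *: lin_mx (mulmx P).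
  by rewrite /sylvester_mx mulfV // subrr scale0r subr0 -mulr2n.
have D0 : \det (sylvester_mx d^-1) != 0.
  rewrite E0 detZ mulf_neq0 ?expf_neq0 //.
  by apply: (det_lin_mx_neq0 (T' := mulmx (invmx P))) => X /=; rewrite mulKmx.
have Z0 : (1 + d * d^-1) *: (P *m ((d / 2%:R) *: invmx P)) -
    (1 - d * d^-1) *: (((d / 2%:R) *: invmx P) *m Q) = d%:M.
  rewrite mulfV // subrr scale0r subr0 -mulr2n -scalemxAr mulmxV // scalerA.
  by rewrite mulrCA mulfV // mulr1 scalemx1.
exists ((1 + d *: 'X) * (1 - d *: 'X) * (\det sylvester_pmx * \det sylvester_solution)).
  rewrite !mulf_neq0 //.
  - apply/eqP => /(congr1 (horner_eval 0))/eqP.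
    by rewrite /horner_eval !hornerE oner_eq0.
  - apply/eqP => /(congr1 (horner_eval 0))/eqP.
    by rewrite /horner_eval !hornerE ?subr0 oner_eq0.
  - apply/eqP => /(congr1 (horner_eval d^-1)); rewrite -det_map_mx horner_sylvester_pmx.
    by rewrite rmorph0 => /eqP; apply/negP.
  - apply/eqP => /(congr1 (horner_eval d^-1)); rewrite -det_map_mx.
    rewrite horner_sylvester_solution (sylvester_solution_det Z0) rmorph0 => /eqP.
    apply/negP; rewrite !detZ mulf_neq0 ?expf_neq0 // mulf_neq0 ?expf_neq0 //.
      by rewrite mulf_neq0 // invr_eq0.
    by rewrite -unitfE -unitmxE unitmx_inv.
move=> t; rewrite !hornerE -![(\det _).[t]]/(horner_eval t _) -!det_map_mx.
rewrite horner_sylvester_pmx horner_sylvester_solution.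
rewrite !mulf_eq0 !negb_or => /andP[/andP[/andP[t1 t2] D1] Z1]; split=> // Z EZ.
move: Z1; rewrite (sylvester_solution_det EZ) detZ mulf_eq0 negb_or.
by case/andP.
Qed.
End SylvesterEquation.

Definition mul_left (C : comNzRingType) (A : algType C) (a x : A) : A := a * x.
Definition mul_right (C : comNzRingType) (A : algType C) (a x : A) : A := x * a.

Section Multiplication.
Variables (C : comNzRingType) (A : algType C) (a : A).
Fact mul_left_linear : linear (mul_left a).
Proof. by move=> c x y; rewrite /mul_left mulrDr scalerAr. Qed.
HB.instance Definition _ := GRing.isLinear.Build C A A *:%R (mul_left a) mul_left_linear.
Fact mul_right_linear : linear (mul_right a).
Proof. by move=> c x y; rewrite /mul_right mulrDl scalerAl. Qed.
HB.instance Definition _ := GRing.isLinear.Build C A A *:%R (mul_right a) mul_right_linear.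
End Multiplication.

(** * Reduced norms of unitary elements *)

Section UnitaryNorm.
Variables (R : comNzRingType) (C : comUnitAlgType R) (A : unitAlgType C).
Variables (sC : {rmorphism C -> C}) (sigma : A -> A).
Hypothesis Cetale : etale_quadratic C.
Hypothesis Afaithful : forall c : C, (forall a : A, c *: a = 0) -> c = 0.
Hypothesis Aproj : fg_projective A.
Hypothesis sCK : involutive sC.
Hypothesis sC_fixed : forall c : C, sC c = c <-> exists r : R, c = r%:A.
Hypothesis sigmaD : forall a b, sigma (a + b) = sigma a + sigma b.
Hypothesis sigmaM : forall a b, sigma (a * b) = sigma b * sigma a.
Hypothesis sigmaK : involutive sigma.
Hypothesis sigmaZ : forall c a, sigma (c *: a) = sC c *: sigma a.
Hypothesis Rsemilocal : semilocal R.
Hypothesis Rinfinite : infinite_residue_fields R.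
Hypothesis Rchar : residue_char_neq2 R.
Variables (S : comAlgType C) (n : nat) (f : A -> 'M[S]_n).
Hypothesis ffS : faithfully_flat S.
Hypothesis fP : splitting f.
Local Notation Nrd := (split_det f).

Lemma half_exists : exists half : R, 2%:R * half = 1.
Proof. exact: unit_of_maximal. Qed.

Lemma points_infinite (L : fieldType) (phi : {rmorphism S -> L}) (k : nat) :
  exists2 s : seq C, size s = k & uniq (map (phi \o GRing.in_alg S) s).
Proof.
have [K KE] : exists K : {rmorphism R -> L}, forall r, phi (r%:A : C)%:A = K r.
  by exists (phi \o GRing.in_alg S \o GRing.in_alg C).
have idK : ideal [set x | K x = 0].
  split; first exact: rmorph0.
  by move=> a u v /= u0 v0; rewrite rmorphD rmorphM u0 v0 mulr0 addr0.
have [|m mm Km] := maximal_over idK; first by move/eqP; rewrite rmorph1 oner_eq0.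
have [s sz_s sP] := incongruent_seq Rinfinite k mm.
exists (map (fun r : R => r%:A : C) s); first by rewrite size_map.
rewrite -map_comp; have := sP L K Km; congr (is_true (uniq _)).
by apply: eq_map => r /=; rewrite KE.
Qed.

Lemma Nrd_in_base b : b \is a GRing.unit -> exists c : C, Nrd b = c%:A.
Proof.
move=> bu; apply: (Nrd_descends fP ffS Afaithful Aproj points_infinite (b' := b^-1)).
exact: mulrV.
Qed.

Lemma Nrd_sigma b c : b \is a GRing.unit -> Nrd b = c%:A -> Nrd (sigma b) = (sC c)%:A.
Proof.
move=> bu; apply: (Nrd_involution fP ffS Afaithful Aproj points_infinite sCK sigmaD
  sigmaM sigmaK sigmaZ (b' := b^-1)).
exact: mulVr.
Qed.

Lemma Nrd_unit b c : b \is a GRing.unit -> Nrd b = c%:A -> c \is a GRing.unit.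
Proof.
move=> bu Nb; have [c' Nb'] : exists c' : C, Nrd b^-1 = c'%:A.
  by apply: Nrd_in_base; rewrite unitrV.
apply/unitrPr; exists c'; apply/eqP; rewrite -subr_eq0; apply/eqP/(ff_inj ffS).
rewrite scalerBl scale1r -scalerA -Nb' -mulr_algl -Nb -split_detM // mulrV //.
by rewrite split_det1 // subrr.
Qed.

Lemma sigma_unit b : b \is a GRing.unit -> sigma b \is a GRing.unit.
Proof.
move=> bu; apply/unitrP; exists (sigma b^-1); rewrite -!sigmaM.
by rewrite mulVr // mulrV // (sigma1 sigmaM sigmaK).
Qed.

Definition point_over (m : set R) (L : fieldType) (phi : {rmorphism S -> L}) :=
  forall r : R, phi (r%:A : C)%:A = 0 <-> m r.

Lemma point_over_exists m : maximal_ideal m -> exists (L : fieldType)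
  (phi : {rmorphism S -> L}) r (G : A -> 'M[L]_r.+1), point_over m phi /\ split_point f phi G.
Proof.
move=> mm; have [half half2] := half_exists.
have [L [phi phiP]] := residue_point Cetale sCK sC_fixed half2 mm ffS.
have [r [G GP]] := split_point_exists fP Afaithful Aproj phi.
by exists L, phi, r, G.
Qed.

(** The product of c and its conjugate lies in R, so a single point over each maximal ideal is
    enough if it sees both factors. *)
Lemma unitC_of_points (c : C) :
  (forall m, maximal_ideal m -> exists (L : fieldType) (phi : {rmorphism S -> L}),
     [/\ point_over m phi, phi c%:A != 0 & phi (sC c)%:A != 0]) ->
  c \is a GRing.unit.
Proof.
move=> h; have [rho Erho] : exists r : R, c * sC c = r%:A.
  by apply/sC_fixed; rewrite rmorphM sCK mulrC.
have [|rho' rhoK] := @unit_of_maximal _ rho.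
  move=> m mm mrho; have [L [phi [phiP c0 c1]]] := h m mm.
  have := (phiP rho).2 mrho; rewrite -Erho -[_%:A]/(GRing.in_alg S _) !rmorphM.
  by move/eqP; rewrite mulf_eq0 (negPf c0) (negPf c1).
apply/unitrPr; exists (sC c * rho'%:A); rewrite mulrA Erho.
by rewrite -scalerAl mul1r scalerA rhoK scale1r.
Qed.

(** The determinant of [T'] in the conjugate presentation is the conjugate of that of [T]; this
    supplies the second factor for [unitC_of_points]. *)
Lemma bijective_of_points (T T' : {linear A -> A}) :
  (forall a, sigma (T (sigma a)) = T' a) ->
  (forall m, maximal_ideal m -> exists (L : fieldType) (phi : {rmorphism S -> L})
     r (G : A -> 'M[L]_r.+1) (TL TL' : {linear 'M[L]_r.+1 -> 'M[L]_r.+1}),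
     [/\ point_over m phi /\ split_point f phi G,
         forall a, G (T a) = TL (G a), forall a, G (T' a) = TL' (G a),
         \det (lin_mx TL) != 0 & \det (lin_mx TL') != 0]) ->
  (forall a, T a = 0 -> a = 0) /\ (forall b, exists a, T a = b).
Proof.
move=> TT' h; have [N [i [p ipK]]] := Aproj.
apply: (endo_det_bijective ipK (d := (endo_det i p T)^-1)); apply: mulVr.
apply: unitC_of_points => m mm.
have [L [phi [r [G [TL [TL' [[phiP GP] GT GT' TL0 TL'0]]]]]]] := h m mm.
exists L, phi; split=> //.
  by have /= -> := pt_endo_det ipK GP GT.
rewrite -(conj_endo_det sCK sigmaD sigmaK sigmaZ i p TT').
by have /= -> := pt_endo_det (conj_inclK sCK sigmaK ipK) GP GT'.
Qed.

Lemma unit_of_points (y : A) :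
  (forall m, maximal_ideal m -> exists (L : fieldType) (phi : {rmorphism S -> L})
     r (G : A -> 'M[L]_r.+1), [/\ point_over m phi, split_point f phi G,
     \det (G y) != 0 & \det (G (sigma y)) != 0]) ->
  y \is a GRing.unit.
Proof.
move=> h; have [|m mm|injy surjy] := @bijective_of_points (mul_left y) (mul_right (sigma y)).
- by move=> a /=; rewrite /mul_left /mul_right sigmaM sigmaK.
- have [L [phi [r [G [phiP GP y0 y1]]]]] := h m mm.
  exists L, phi, r, G, (mulmx (G y)), (mulmxr (G (sigma y))).
  rewrite -!unitfE -!unitmxE in y0 y1.
  split=> // [a|a||]; rewrite ?[LHS](pt_mul GP) //.
    by apply: (det_lin_mx_neq0 (T' := mulmx (invmx (G y)))) => X /=; rewrite mulKmx.
  by apply: (det_lin_mx_neq0 (T' := mulmxr (invmx (G (sigma y))))) => X /=; rewrite mulmxK.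
have [z yz] := surjy 1; rewrite /= /mul_left in yz.
apply/unitrP; exists z; split=> //; apply/eqP; rewrite -subr_eq0; apply/eqP/injy.
by rewrite /= /mul_left mulrBr mulrA yz mul1r mulr1 subrr.
Qed.

Lemma scalar_point (L : fieldType) (phi : {rmorphism S -> L}) :
  exists K : {rmorphism R -> L}, forall r, phi (r%:A : C)%:A = K r.
Proof. by exists (phi \o GRing.in_alg S \o GRing.in_alg C). Qed.

(** A value is chosen at one point over each maximal ideal, and the Chinese remainder theorem glues
    these values. The result lies in R and is therefore fixed by [sC]. *)
Lemma generic_scalar (good : forall (L : fieldType) (phi : {rmorphism S -> L}) (r : nat)
    (G : A -> 'M[L]_r.+1), L -> Prop) :
  (forall m (L : fieldType) (phi : {rmorphism S -> L}) r (G : A -> 'M[L]_r.+1),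
     maximal_ideal m -> point_over m phi -> split_point f phi G ->
     exists2 p : {poly L}, p != 0 & forall t, p.[t] != 0 -> good L phi r G t) ->
  exists beta : R, forall m, maximal_ideal m -> exists (L : fieldType)
    (phi : {rmorphism S -> L}) r (G : A -> 'M[L]_r.+1),
    [/\ point_over m phi, split_point f phi G & good L phi r G (phi (beta%:A : C)%:A)].
Proof.
move=> h; have [ms [eps cr]] := chinese_idempotents Rsemilocal.
pose Q (m : set R) b := maximal_ideal m -> exists (L : fieldType)
    (phi : {rmorphism S -> L}) r (G : A -> 'M[L]_r.+1),
    [/\ point_over m phi, split_point f phi G & good L phi r G (phi (b%:A : C)%:A)].
have /choice[b bP] m : exists b, Q m b.
  have [mm|nm] := pselect (maximal_ideal m); last by exists 0 => /nm.
  have [L [phi [r [G [phiP GP]]]]] := point_over_exists mm.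
  have [p p0 pP] := h m L phi r G mm phiP GP; have [K KE] := scalar_point phi.
  have Kinf k : exists2 s : seq R, size s = k & uniq (map K s).
    have [s sz_s sP] := incongruent_seq Rinfinite k mm; exists s => //.
    by apply: sP => x; rewrite -KE => /phiP.
  have [b pb] := nonroot Kinf p0; exists b => _; exists L, phi, r, G; split=> //.
  by rewrite KE; exact: pP.
exists (\sum_(m <- ms) eps m * b m) => m mm.
have [L [phi [r [G [phiP GP gG]]]]] := bP m mm; exists L, phi, r, G; split=> //.
have [K KE] := scalar_point phi; move: gG; rewrite !KE rmorph_sum.
have KP x : K x = 0 <-> m x by rewrite -KE; exact: phiP.
under eq_bigr do rewrite rmorphM.
by rewrite (chinese_sum cr (fun m => K (b m)) mm KP).
Qed.

Lemma skew_element : exists e : C, sC e = - e /\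
  forall m (L : fieldType) (phi : {rmorphism S -> L}),
    maximal_ideal m -> point_over m phi -> phi e%:A != 0.
Proof.
have [half half2] := half_exists.
have [ms [eps cr]] := chinese_idempotents Rsemilocal.
pose Q (m : set R) (e : C) := sC e = - e /\ (maximal_ideal m ->
  exists (L : fieldType) (phi : {rmorphism S -> L}), point_over m phi /\ phi e%:A != 0).
have /choice[e eP] m : exists e, Q m e.
  have [mm|nm] := pselect (maximal_ideal m); last first.
    by exists 0; split=> [|/nm //]; rewrite rmorph0 oppr0.
  have [L [phi [r [G [phiP _]]]]] := point_over_exists mm.
  have [e se e0] := skew_exists Cetale sCK sC_fixed half2 mm (g := phi \o GRing.in_alg S) phiP.
  by exists e; split=> // _; exists L, phi.
pose e0 := \sum_(m <- ms) eps m *: e m.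
have se0 : sC e0 = - e0.
  rewrite rmorph_sum -sumrN; apply: eq_bigr => m _ /=.
  by rewrite (sC_scale sC_fixed) (eP m).1 scalerN.
exists e0; split=> // m L phi mm phiP.
(* The square of [e0] lies in R, so its vanishing depends on m alone; this carries nonvanishing from
   one point over m to all of them. *)
have [d Ed] : exists d : R, e0 * e0 = d%:A.
  by apply/sC_fixed; rewrite rmorphM se0 mulrNN.
have [L' [phi' [phiP' em0]]] := (eP m).2 mm.
have e0m : phi' e0%:A = phi' (e m)%:A.
  have [K KE] := scalar_point phi'.
  have KP x : K x = 0 <-> m x by rewrite -KE; exact: phiP'.
  rewrite -[RHS](chinese_sum cr (fun m => phi' (e m)%:A) mm KP).
  rewrite /e0 scaler_suml rmorph_sum; apply: eq_bigr => m' _.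
  by rewrite -KE -rmorphM; congr (phi' _); rewrite mulr_algl scalerA mulr_algl.
apply: contra_neq em0 => e00; apply/eqP; rewrite -e0m -sqrf_eq0 -rmorphXn.
have sq : (e0%:A : S) ^+ 2 = (e0 * e0)%:A by rewrite expr2 -[RHS]scalerA mulr_algl.
rewrite sq Ed; apply/eqP/phiP'/phiP; rewrite -Ed -sq rmorphXn.
by rewrite e00 expr0n.
Qed.
Lemma two_neq0 m (L : fieldType) (phi : {rmorphism S -> L}) :
  maximal_ideal m -> point_over m phi -> 2%:R != 0 :> L.
Proof.
move=> mm phiP; have [K KE] := scalar_point phi.
apply/eqP => L2; apply: (Rchar mm); apply/phiP.
by rewrite KE rmorph_nat.
Qed.

Lemma unitary_unit u : u * sigma u = 1 -> u \is a GRing.unit.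
Proof.
move=> uu; apply: unit_of_points => m mm.
have [L [phi [r [G [phiP GP]]]]] := point_over_exists mm.
have : G u *m G (sigma u) = 1%:M by rewrite -(pt_mul GP) uu (pt_one GP).
by case/mulmx1_unit; rewrite !unitmxE !unitfE; exists L, phi, r, G.
Qed.

Lemma sigma_scalar c : sigma c%:A = (sC c)%:A.
Proof. by rewrite sigmaZ (sigma1 sigmaM sigmaK). Qed.

Lemma unitary_Nrd u c : u * sigma u = 1 -> Nrd u = c%:A ->
  exists y c', [/\ y \is a GRing.unit, Nrd y = c'%:A & c = c' / sC c'].
Proof.
move=> uu Nu; have uU := unitary_unit uu.
have su : sigma u * u = 1.
  by rewrite -[sigma u]mul1r -(mulVr uU) -(mulrA _ u) uu mulr1 mulVr.
have [e [se eP]] := skew_element.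
pose good (L : fieldType) (phi : {rmorphism S -> L}) (r : nat) (G : A -> 'M[L]_r.+1) t :=
  \det ((1 + phi e%:A * t)%:M + (1 - phi e%:A * t) *: G u) != 0.
have [|beta betaP] := @generic_scalar good.
  move=> m L phi r G mm phiP GP; set d := phi e%:A.
  have d0 : d != 0 := eP m L phi mm phiP.
  pose M : 'M[{poly L}]_r.+1 := (1 + d *: 'X)%:M + (1 - d *: 'X) *: map_mx polyC (G u).
  have EM t : map_mx (horner_eval t) M = (1 + d * t)%:M + (1 - d * t) *: G u.
    by apply/matrixP => i j; rewrite !mxE /horner_eval !hornerE hornerMn !hornerE.
  exists (\det M) => [|t]; last by rewrite -[_.[t]]/(horner_eval t _) -det_map_mx EM.
  (* At t = 1/d the coefficient of [G u] vanishes and the scalar matrix 2 remains. *)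
  apply/eqP => /(congr1 (horner_eval d^-1)); rewrite -det_map_mx rmorph0 EM.
  apply/eqP; rewrite mulfV // subrr scale0r addr0 det_scalar expf_neq0 //.
  exact: two_neq0 mm phiP.
pose th : C := 1 + beta *: e.
have sth : sC th = 1 - beta *: e.
  by rewrite /th rmorphD rmorph1 (sC_scale sC_fixed) se scalerN.
pose y := th%:A + sC th *: u.
have sy : sigma y = sigma u * y.
  rewrite /y sigmaD sigma_scalar sigmaZ sCK mulrDr -!scalerAr mulr1 su addrC //.
have yU : y \is a GRing.unit.
  apply: unit_of_points => m mm; have [L [phi [r [G [phiP GP gG]]]]] := betaP m mm.
  have Gy : G y = (1 + phi e%:A * phi (beta%:A : C)%:A)%:M +
      (1 - phi e%:A * phi (beta%:A : C)%:A) *: G u.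
    have [K KE] : exists K : {rmorphism C -> L}, forall c, phi c%:A = K c.
      by exists (phi \o GRing.in_alg S).
    rewrite /y (ptD GP) !(ptZ GP) (pt_one GP) /= !KE sth /th.
    rewrite -[beta *: e]mulr_algl rmorphB rmorphD !rmorphM rmorph1 scalemx1.
    by rewrite (mulrC (K e)).
  have gy : \det (G y) != 0 by rewrite Gy.
  exists L, phi, r, G; split=> //; rewrite sy (pt_mul GP) det_mulmx mulf_neq0 //.
  have : G (sigma u) *m G u = 1%:M by rewrite -(pt_mul GP) su (pt_one GP).
  by case/mulmx1_unit; rewrite unitmxE unitfE.
have [c' Nc'] := Nrd_in_base yU.
exists y, c'; split=> //; have c'U := Nrd_unit yU Nc'.
have Nsy := Nrd_sigma yU Nc'.
have sc'U : sC c' \is a GRing.unit by rewrite rmorph_unit.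
apply: (mulIr sc'U); rewrite divrK //; apply/eqP; rewrite -subr_eq0; apply/eqP/(ff_inj ffS).
have : u * sigma y = y by rewrite sy mulrA uu mul1r.
move/(congr1 Nrd); rewrite (split_detM fP) Nu Nsy Nc' => E.
by rewrite scalerBl -E -scalerA mulr_algl subrr.
Qed.

Lemma Nrd_unitary a c : a \is a GRing.unit -> Nrd a = c%:A ->
  exists u, u * sigma u = 1 /\ Nrd u = (c / sC c)%:A.
Proof.
move=> aU Na; have [e [se eP]] := skew_element.
pose good (L : fieldType) (phi : {rmorphism S -> L}) (r : nat) (G : A -> 'M[L]_r.+1) t :=
  let d := phi e%:A in let P := G a in let Q := G (sigma a) in
  [/\ 1 + d * t != 0, 1 - d * t != 0, \det (sylvester_mx P Q d t) != 0 &
   forall Z, (1 + d * t) *: (P *m Z) - (1 - d * t) *: (Z *m Q) = d%:M -> \det Z != 0].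
have [|beta betaP] := @generic_scalar good.
  move=> m L phi r G mm phiP GP; apply: sylvester_generic.
  - exact: eP mm phiP.
  - exact: two_neq0 mm phiP.
  - have : G a *m G a^-1 = 1%:M by rewrite -(pt_mul GP) mulrV // (pt_one GP).
    by case/mulmx1_unit.
pose th : C := 1 + beta *: e.
have sth : sC th = 1 - beta *: e.
  by rewrite /th rmorphD rmorph1 (sC_scale sC_fixed) se scalerN.
have phith (L : fieldType) (phi : {rmorphism S -> L}) :
    phi th%:A = 1 + phi e%:A * phi (beta%:A : C)%:A /\
    phi (sC th)%:A = 1 - phi e%:A * phi (beta%:A : C)%:A.
  have [K KE] : exists K : {rmorphism C -> L}, forall c, phi c%:A = K c.
    by exists (phi \o GRing.in_alg S).
  rewrite !KE sth /th -[beta *: e]mulr_algl rmorphB rmorphD !rmorphM rmorph1.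
  by rewrite (mulrC (K e)).
have thU : th \is a GRing.unit.
  apply: unitC_of_points => m mm.
  have [L [phi [r [G [phiP GP [t0 t1 _ _]]]]]] := betaP m mm.
  by exists L, phi; have [-> ->] := phith L phi.
(* Conjugating [T] by sigma exchanges its two terms, so it only changes the sign; one determinant
   serves for both hypotheses of [bijective_of_points]. *)
have [T [T' [TE T'E]]] : exists T T' : {linear A -> A},
    (forall z, T z = th *: (a * z) - sC th *: (z * sigma a)) /\ forall z, T' z = - T z.
  exists (mul_left (th *: a) \- mul_right (sC th *: sigma a)).
  exists (mul_right (sC th *: sigma a) \- mul_left (th *: a)).
  split=> z /=; last by rewrite opprB.
  by rewrite /mul_left /mul_right -scalerAl -scalerAr.
have sB x y : sigma (x - y) = sigma x - sigma y.
  by rewrite -scaleN1r sigmaD sigmaZ rmorphN1 scaleN1r.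
have sT z : sigma (T (sigma z)) = T' z.
  by rewrite T'E !TE opprB sB !sigmaZ !sigmaM sCK !sigmaK.
have GTE (L : fieldType) (phi : {rmorphism S -> L}) r (G : A -> 'M[L]_r.+1) z :
    split_point f phi G -> let d := phi e%:A in let t := phi (beta%:A : C)%:A in
    G (T z) = (1 + d * t) *: (G a *m G z) - (1 - d * t) *: (G z *m G (sigma a)).
  move=> GP /=; have [<- <-] := phith L phi.
  by rewrite TE -scaleN1r (ptD GP) !(ptZ GP) rmorphN1 scaleN1r !(pt_mul GP).
have [|injT surjT] := bijective_of_points sT.
  move=> m mm; have [L [phi [r [G [phiP GP [_ _ D0 _]]]]]] := betaP m mm.
  set d := phi e%:A in D0; set t := phi _ in D0.
  exists L, phi, r, G,
    (((1 + d * t) \*: mulmx (G a)) \- ((1 - d * t) \*: mulmxr (G (sigma a)))).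
  exists (((1 - d * t) \*: mulmxr (G (sigma a))) \- ((1 + d * t) \*: mulmx (G a))).
  split=> // [z|z||].
  - exact: GTE.
  - rewrite T'E -[- T z]scaleN1r (ptZ GP) rmorphN1 scaleN1r (GTE _ _ _ _ _ GP).
    by rewrite opprB.
  - by rewrite (lin_mx_unique (M := sylvester_mx (G a) (G (sigma a)) d t)) // => X;
      rewrite sylvester_mxE.
  - rewrite (lin_mx_unique (M := - sylvester_mx (G a) (G (sigma a)) d t)) => [|X].
      by rewrite -scaleN1r detZ mulf_neq0 // signr_eq0.
    by rewrite mulmxN sylvester_mxE -linearN opprB.
have [s Ts] := surjT e%:A.
have ss : sigma s = s.
  apply/eqP; rewrite -subr_eq0; apply/eqP/injT; rewrite linearB Ts.
  rewrite -[T _]sigmaK sT T'E Ts -scaleNr sigma_scalar rmorphN se opprK.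
  by rewrite scaleNr subrr.
have sU : s \is a GRing.unit.
  apply: unit_of_points => m mm.
  have [L [phi [r [G [phiP GP [_ _ _ Z0]]]]]] := betaP m mm.
  have Gs : \det (G s) != 0.
    by apply: Z0; rewrite -(GTE _ _ _ _ _ GP) Ts (ptZ GP) (pt_one GP) scalemx1.
  by exists L, phi, r, G; rewrite ss.
have unitZ k (v : A) : k \is a GRing.unit -> v \is a GRing.unit ->
    k *: v \is a GRing.unit.
  move=> kU vU; apply/unitrP; exists (k^-1 *: v^-1).
  by rewrite -!scalerAl -!scalerAr !scalerA mulVr // mulrV // mulVr // mulrV // scale1r.
have sthU : sC th \is a GRing.unit by rewrite rmorph_unit.
have [x Ex] : {x | x = th *: (a * s)} by exists (th *: (a * s)).
have sx : sigma x = sC th *: (s * sigma a) by rewrite Ex sigmaZ sigmaM ss.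
have xs : x - sigma x = e%:A by rewrite -Ts TE sx Ex.
have xU : x \is a GRing.unit by rewrite Ex unitZ // unitrMl.
have sxU := sigma_unit xU.
have xsx : x * sigma x = sigma x * x.
  move: (sigma x) xs => v xv; have -> : x = e%:A + v by rewrite -xv subrK.
  by rewrite mulrDl mulrDr -scalerAl -scalerAr mul1r mulr1.
have ssxV : sigma (sigma x)^-1 = x^-1.
  apply: (mulrI xU); rewrite mulrV // -{1}[x]sigmaK -sigmaM mulVr //.
  by rewrite (sigma1 sigmaM sigmaK).
(* The scalar cancels th / sigma(th) from x / sigma(x), so that theta does not enter the norm with
   an exponent depending on the degree. *)
pose u := (sC th / th) *: (x / sigma x); exists u; split.
  rewrite /u sigmaZ sigmaM ssxV rmorphM sCK rmorphV // -scalerAl -scalerAr scalerA.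
  have -> : sC th / th * (th / sC th) = 1.
    by rewrite mulrA divrK // divrr.
  by rewrite scale1r mulrA -(mulrA x) -invrM // xsx invrM // mulVKr // mulVr.
have usx : u * (s * sigma a) = a * s.
  have : u * sigma x = (sC th / th) *: x by rewrite /u -scalerAl divrK.
  rewrite sx Ex -scalerAr scalerA divrK // => /(congr1 ( *:%R (sC th)^-1)).
  by rewrite !scalerA mulVr // !scale1r.
have Nsa := Nrd_sigma aU Na; have cU := Nrd_unit aU Na.
have scU : sC c \is a GRing.unit by rewrite rmorph_unit.
have NsV : Nrd s^-1 * Nrd s = 1 by rewrite -(split_detM fP) mulVr // (split_det1 f).
have cV : (sC c)%:A * ((sC c)^-1)%:A = 1 :> S.
  by rewrite mulr_algl scalerA divrr // scale1r.
(* In u (s sigma(a)) = a s the norm of s occurs on both sides and is invertible in S. *)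
have cancel (p q w z z' k : S) : p * q = 1 -> z * z' = 1 -> w * (q * z) = k * q -> w = k * z'.
  move=> pq zz' E; transitivity (p * (w * (q * z)) * z').
    by rewrite -[LHS]mulr1 -zz' -[LHS]mul1r -pq; ring.
  by rewrite E -[k in RHS]mul1r -pq; ring.
move/(congr1 Nrd): usx; rewrite !(split_detM fP) Na Nsa => /(cancel _ _ _ _ _ _ NsV cV) ->.
by rewrite mulr_algl scalerA.
Qed.

End UnitaryNorm.

Theorem mainTheorem6 (R : comNzRingType) (C : comUnitAlgType R)
    (A : unitAlgType C) (sigma : A -> A) (sigmaC : C -> C)
    (Rnoetherian : noetherian R)
    (Rsemilocal : semilocal R)
    (Rinfinite : infinite_residue_fields R)
    (Rchar : residue_char_neq2 R)
    (Asigma : azumaya_unitary sigma sigmaC) :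
  Nrd_image (unitary_group sigma) =
  one_minus sigmaC (Nrd_image [set a : A | a \is a GRing.unit]).
Proof.
case: Asigma => Cetale [Aproj Afaithful _ _] _ sD sM sK _ sres sfix.
(* Faithfulness embeds C in A; the ring laws of [sigmaC] are then read off from those of [sigma] on
   scalars. *)
have Cinj (c d : C) : c%:A = d%:A :> A -> c = d.
  move=> cd; apply/eqP; rewrite -subr_eq0; apply/eqP/Afaithful => a.
  by rewrite -[a]mul1r scalerAl scalerBl cd subrr mul0r.
have sCD c d : sigmaC (c - d) = sigmaC c - sigmaC d.
  apply: (addIr (sigmaC d)); apply: Cinj; rewrite subrK scalerDl -!sres -sD -scalerDl.
  by rewrite subrK.
have s1 : sigma 1 = 1.
  by rewrite -[LHS]mul1r -{1}[1]sK -sM mul1r sK.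
have sC1 : sigmaC 1 = 1 by apply: Cinj; rewrite -sres scale1r s1.
have sZ c a : sigma (c *: a) = sigmaC c *: sigma a.
  by rewrite -mulr_algl sM sres mulr_algr.
have sCM c d : sigmaC (c * d) = sigmaC c * sigmaC d.
  by apply: Cinj; rewrite -sres -[in LHS]scalerA sZ sres scalerA.
have sCK c : sigmaC (sigmaC c) = c by apply: Cinj; rewrite -!sres sK.
pose sC : {rmorphism C -> C} := HB.pack_for {rmorphism C -> C} sigmaC
  (GRing.isZmodMorphism.Build C C sigmaC sCD)
  (GRing.isMonoidMorphism.Build C C sigmaC (conj sC1 sCM)).
(* In each inclusion the splitting that witnesses the given norm also witnesses the norm to be
   produced. *)
apply/seteqP; split=> [c [u uu [S [n [f [ffS fP Nu]]]]]|_ [c [a aU [S [n [f [ffS fP Na]]]]] <-]].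
  have [y [c' [yU Ny ->]]] := @unitary_Nrd R C A sC sigma Cetale Afaithful Aproj sCK sfix
    sD sM sK sZ Rsemilocal Rinfinite Rchar S n f ffS fP u c uu Nu.
  by exists c' => //; exists y => //; exists S, n, f.
have [u [uu Nu]] := @Nrd_unitary R C A sC sigma Cetale Afaithful Aproj sCK sfix
    sD sM sK sZ Rsemilocal Rinfinite Rchar S n f ffS fP a c aU Na.
by exists u => //; exists S, n, f.
Qed.
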